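(* Let $\mathcal A=(A_j)_{j\ge1}$ be a partition of $\mathbb R^d$ into cubes of side length $s\in(0,1]$. Let $X:=[-1,1]^d$ and let $P$ be a probability measure on $X\times\{-1,1\}$ with fixed version $\eta\colon X\to[0,1]$ of its posterior probability. Assume that the associated distance to the decision boundary $\Delta_\eta$ controls the noise from below by the exponent $\gamma\in[0,\infty)$ (with constant $c_{\mathrm{LC}}$), and that $P$ has margin-noise exponent (MNE) $\beta\in(0,\infty]$ (with constant $c_{\mathrm{MNE}}$) and margin exponent (ME) $\alpha\in(0,\infty]$ (with constant $c_{\mathrm{ME}}$). Furthermore, let $X_0=\partial_XX_1=\partial_XX_{-1}$ with $\mathcal H^{d-1}(X_0)>0$ and let $X_0$ be $(d-1)$-rectifiable. Let $L$ be the classification loss and, for fixed $n\ge1$ and $\tau\ge1$, let the bounds $$s\le\tilde c_{\alpha,\gamma,d}^{\;\frac{(1+\gamma)(\alpha+\gamma)+\gamma^2}{(1+\gamma)(\alpha+\gamma)+\gamma^2+d\gamma}}\left(\frac{\tau}{n}\right)^{\frac{\gamma}{(1+\gamma)(\alpha+\gamma)+\gamma^2+d\gamma}}$$ and $$s^dn\ge\tau\left(\frac{\tilde c_{\alpha,\gamma,d}}{\min\{\frac{\delta^*}{3},1\}}\right)^{\frac{(1+\gamma)(\alpha+\gamma)+\gamma^2}{\gamma}}$$ be satisfied, where the constants $\tilde c_{\alpha,\gamma,d}$ and $\delta^*>0$ are those given in the context. Then there exists a constant $c_{\alpha,\gamma,d}>0$ such that $$\mathcal R_{L,P}(h_{D,s})-\mathcal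 R^*_{L,P}\le 6\,(c_{\mathrm{MNE}}s)^\beta+c_{\alpha,\gamma,d}\left(\frac{\tau}{s^dn}\right)^{\frac{(1+\gamma)(\alpha+\gamma)}{(1+\gamma)(\alpha+\gamma)+\gamma^2}}$$ holds with probability $P^n\ge1-2e^{-\tau}$, where the constant $c_{\alpha,\gamma,d}$ only depends on $\alpha,\gamma$ and $d$.
   Context: **Data, loss, risks.** $Y:=\{-1,1\}$; $D=((x_1,y_1),\dots,(x_n,y_n))$ is drawn i.i.d. from $P$, and $P^n$ is the product measure. The classification loss is $L(y,t):=\mathbf 1_{(-\infty,0]}(y\cdot\operatorname{sign}t)$ for $y\in Y$, $t\in\mathbb R$, with $\operatorname{sign}t=1$ for $t\ge0$ and $-1$ for $t<0$. For measurable $f\colon X\to\mathbb R$, $\mathcal R_{L,P}(f):=\int_{X\times Y}L(y,f(x))\,dP(x,y)$, and $\mathcal R^*_{L,P}:=\inf_{f\colon X\to\mathbb R}\mathcal R_{L,P}(f)$ (over measurable $f$) is the Bayes risk. **Histogram rule.** For $x\in X$ let $A(x)$ be the unique cell of $\mathcal A$ with $x\in A(x)$. Put $f_{D,s}(x):=\frac1n\sum_{i=1}^n\mathbf 1_{\{y_i=1\}}\mathbf 1_{A(x)}(x_i)-\frac1n\sum_{i=1}^n\mathbf 1_{\{y_i=-1\}}\mathbf 1_{A(x)}(x_i)$. The empirical histogram rule is $h_{D,s}:=\operatorname{sign}f_{D,s}$. **Posterior probability and decision boundary.** $P_X$ is the marginal distribution of $P$ on $X$; $\eta(x)=P(y=1|x)$.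 $X_1:=\{x\in X:\eta(x)>1/2\}$, $X_{-1}:=\{x\in X:\eta(x)<1/2\}$, $X_0:=\{x\in X:\eta(x)=1/2\}$. $\partial_XT$ is the relative boundary of $T$ in $X$. The distance to the decision boundary $\Delta_\eta\colon X\to[0,\infty]$ is $\Delta_\eta(x):=d(x,X_1)$ if $x\in X_{-1}$, $\Delta_\eta(x):=d(x,X_{-1})$ if $x\in X_1$, and $\Delta_\eta(x):=0$ otherwise, where $d(x,A):=\inf_{x'\in A}d(x,x')$ and $d(x,x')=\|x-x'\|_\infty$. **Exponents.** $P$ has ME $\alpha\in(0,\infty]$ if there is a constant $c_{\mathrm{ME}}>0$ with $P_X(\{\Delta_\eta(x)<t\})\le(c_{\mathrm{ME}}t)^\alpha$ for all $t>0$. $P$ has MNE $\beta\in(0,\infty]$ if there is a constant $c_{\mathrm{MNE}}>0$ with $\int_{\{\Delta_\eta<t\}}|2\eta(x)-1|\,dP_X(x)\le(c_{\mathrm{MNE}}t)^\beta$ for all $t>0$. $\Delta_\eta$ controls the noise from below by the exponent $\gamma\in[0,\infty)$ if there is a constant $c_{\mathrm{LC}}>0$ with $\Delta_\eta^\gamma(x)\le c_{\mathrm{LC}}|2\eta(x)-1|$ for $P_X$-almost all $x\in X$. **Geometry.** $\lambda^d$ is the Lebesgue measure and $\mathcal H^{d-1}$ the $(d-1)$-dimensional Hausdorff measure on $\mathbb R^d$. A set $T\subset X$ is $m$-rectifiable for an integer $m>0$ if there is a Lipschitz function mapping some bounded subset of $\mathbb R^m$ onto $T$. **Constants.** $$\hat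 c:=32\max\{12\,\mathcal H^{d-1}(\{\eta=1/2\}),1\}\cdot\max\Big\{1,\tfrac{\alpha+\gamma}{\gamma}\,c_{\mathrm{ME}}^{\frac{\alpha\gamma}{\alpha+\gamma}}\big(\tfrac{\gamma c_{\mathrm{LC}}}{\alpha}\big)^{\frac{\alpha}{\alpha+\gamma}}\Big\},$$ $$\tilde c_{\alpha,\gamma,d}:=\left(\frac{16\gamma(\alpha+2\gamma)\cdot8^{d+1}\max\{c_{\mathrm{LC}},2^\gamma\}\cdot(\alpha+\gamma)^{-1}}{\hat c^{\frac{\alpha+\gamma}{\alpha+2\gamma}}}\right)^{\frac{\alpha+\gamma}{\alpha+\gamma+\gamma(\alpha+2\gamma)}}.$$ $\delta^*>0$ is a constant such that $\lambda^d(\{x\in X:\Delta_\eta(x)\le\delta\})\le4\,\mathcal H^{d-1}(\{x\in X:\eta(x)=1/2\})\cdot\delta$ for all $\delta\in(0,\delta^*]$.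
   Formalization: The constant c_{α,γ,d} may also depend on c_LC, c_ME and H^{d-1}(X_0), the constants entering c̃_{α,γ,d}; with dependence on α, γ, d alone the claim fails, e.g. for P_X uniform on [-1,1]^2, η=(1+εx_1)/2, ε→0. *)

(* Defs.v *)
From HB Require Import structures.
From mathcomp Require Import all_boot all_order all_algebra.
From mathcomp Require Import all_classical all_reals all_analysis.

Set Implicit Arguments.
Unset Strict Implicit.
Unset Printing Implicit Defensive.

Import Order.TTheory GRing.Theory Num.Theory.
Import numFieldNormedType.Exports.

Local Open Scope classical_set_scope.
Local Open Scope ring_scope.

(* Points of R^d are row vectors, on which the library norm is the sup norm.
   They get the sigma-algebra generated by the coordinates (the Borel
   sigma-algebra), as the library does for d.-tuple R. *)
Definition rV_display : measure_display -> measure_display.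
Proof. exact. Qed.

Section measurable_rV.
Context (R : realType) (d : nat).

Let coors : 'I_d -> 'rV[R]_d -> R := fun i x => x ord0 i.

Let rV_set0 : g_sigma_preimage coors set0.
Proof. exact: sigma_algebra0. Qed.

Let rV_setC A : g_sigma_preimage coors A -> g_sigma_preimage coors (~` A).
Proof. exact: sigma_algebraC. Qed.

Let rV_bigcup (F : _^nat) : (forall i, g_sigma_preimage coors (F i)) ->
  g_sigma_preimage coors (\bigcup_i (F i)).
Proof. exact: sigma_algebra_bigcup. Qed.

HB.instance Definition _ := @isMeasurable.Build
  (rV_display default_measure_display) 'rV[R]_d
  (g_sigma_preimage coors) rV_set0 rV_setC rV_bigcup.

End measurable_rV.

(* x ^ e for real x >= 0 and e in (0, +oo], with
   x ^ +oo = 0, 1, +oo according to x < 1, x = 1, x > 1. *)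
Definition xpow (R : realType) (x : R) (e : \bar R) : \bar R :=
  match e with
  | r%:E => (x `^ r)%:E
  | _ => if x < 1 then 0%E else if x == 1 then 1%E else +oo%E
  end.

(* n-fold product of a sigma-finite measure with itself, as an iterated
   integral: the value at n.+1 is that of mu \x (power_measure mu n),
   transported to tuples by cons. *)
Fixpoint power_measure (disp : measure_display) (T : measurableType disp)
    (R : realType) (mu : set T -> \bar R) (n : nat) :
    set (n.-tuple T) -> \bar R :=
  match n with
  | 0 => fun A => (\1_A [tuple])%:E
  | m.+1 => fun A =>
      (\int[mu]_x power_measure mu [set t : m.-tuple T | A [tuple of x :: t]])%E
  end.

Section geometry.
Context (R : realType) (d : nat).
Implicit Types (x y : 'rV[R]_d) (A T : set 'rV[R]_d).

Definition lebesgue_rV A : \bar R :=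
  power_measure (@lebesgue_measure R)
    [set t : d.-tuple R | A (\row_i tnth t i)].

Definition euclid_dist x y : R :=
  Num.sqrt (\sum_(i < d) (x ord0 i - y ord0 i) ^+ 2).

Definition euclid_diam A : \bar R :=
  ereal_sup [set (euclid_dist x.1 x.2)%:E | x in A `*` A].

(* Volume of the Euclidean unit ball of R^m. *)
Fixpoint unit_ball_volume (m : nat) : R :=
  match m with
  | 0 => 1
  | 1 => 2
  | k.+2 => 2 * pi / m%:R * unit_ball_volume k
  end.

Definition hausdorff_weight (m : nat) A : \bar R :=
  if A == set0 then 0%E
  else ((unit_ball_volume m / 2 ^+ m)%:E * euclid_diam A ^+ m)%E.

Definition hausdorff_pre (m : nat) (delta : R) A : \bar R :=
  ereal_inf [set (\sum_(0 <= k <oo) hausdorff_weight m (U k))%E |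
    U in [set U : nat -> set 'rV[R]_d |
      A `<=` \bigcup_k U k /\ forall k, (euclid_diam (U k) <= delta%:E)%E]].

(* m-dimensional Hausdorff measure, for the Euclidean metric and with the
   normalization that makes it agree with Lebesgue measure when m = d. *)
Definition hausdorff (m : nat) A : \bar R :=
  ereal_sup [set hausdorff_pre m delta A | delta in [set e : R | 0 < e]].

Definition rectifiable (m : nat) T : Prop :=
  (0 < m)%N /\
  exists (B : set 'rV[R]_m) (f : 'rV[R]_m -> 'rV[R]_d),
    [/\ bounded_set B, [lipschitz f z | z in B] & f @` B = T].

Definition set_dist x A : \bar R := ereal_inf [set `|x - y|%:E | y in A].

Definition is_cube (s : R) A : Prop :=
  exists (a : 'rV[R]_d) (b c : 'I_d -> bool),
    A = [set x : 'rV[R]_d | forall i, x ord0 i \in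
           Interval (BSide (b i) (a ord0 i)) (BSide (c i) (a ord0 i + s))].

Definition cubic_partition (s : R) (A : nat -> set 'rV[R]_d) : Prop :=
  [/\ forall j, is_cube s (A j), trivIset setT A & \bigcup_j A j = setT].

Definition domain : set 'rV[R]_d :=
  [set x : 'rV[R]_d | forall i, -1 <= x ord0 i <= 1].

Definition rel_boundary T : set 'rV[R]_d :=
  domain `&` closure T `&` closure (domain `\` T).

End geometry.

Arguments domain {R d}.

Section classification.
Context (R : realType) (d : nat).

(* Y = {-1, 1}, with true standing for the label 1 and false for -1. *)
Definition label (b : bool) : R := if b then 1 else -1.

Definition sign (t : R) : R := if 0 <= t then 1 else -1.

Definition class_loss (y : bool) (t : R) : R := (label y * sign t <= 0)%R%:R.

(* P is a measure on R^d x Y; in the theorem it gives mass 1 to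
   domain x Y. *)
Variable P : probability ('rV[R]_d * bool)%type R.

Definition risk (f : 'rV[R]_d -> R) : \bar R :=
  (\int[P]_(z in domain `*` setT) (class_loss z.2 (f z.1))%:E)%E.

Definition bayes_risk : \bar R :=
  ereal_inf [set risk f | f in [set f | measurable_fun domain f]].

Definition marginal : set 'rV[R]_d -> \bar R := pushforward P fst.

Definition is_posterior (eta : 'rV[R]_d -> R) : Prop :=
  [/\ measurable_fun domain eta,
      forall x, domain x -> 0 <= eta x <= 1 &
      forall B, measurable B -> B `<=` domain ->
        P (B `*` [set true]) = (\int[marginal]_(x in B) (eta x)%:E)%E].

Variable eta : 'rV[R]_d -> R.

Definition Xpos : set 'rV[R]_d := [set x | domain x /\ 2^-1 < eta x].
Definition Xneg : set 'rV[R]_d := [set x | domain x /\ eta x < 2^-1].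
Definition Xzero : set 'rV[R]_d := [set x | domain x /\ eta x = 2^-1].

Definition Delta (x : 'rV[R]_d) : \bar R :=
  if x \in Xneg then set_dist x Xpos
  else if x \in Xpos then set_dist x Xneg
  else 0%E.

Definition has_ME (alpha : \bar R) (c : R) : Prop :=
  0 < c /\ forall t : R, 0 < t ->
    (marginal [set x | domain x /\ (Delta x < t%:E)%E] <= xpow (c * t)%R alpha)%E.

Definition has_MNE (beta : \bar R) (c : R) : Prop :=
  0 < c /\ forall t : R, 0 < t ->
    (\int[marginal]_(x in [set x | domain x /\ (Delta x < t%:E)%E])
       `|2 * eta x - 1|%:E <= xpow (c * t)%R beta)%E.

Definition controls_noise (gamma c : R) : Prop :=
  0 < c /\
  {ae marginal, forall x, domain x ->
     (poweR (Delta x) gamma <= (c * `|2 * eta x - 1|)%:E)%E}.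

End classification.

Section histogram.
Context (R : realType) (d n : nat).
Variables (A : nat -> set 'rV[R]_d) (D : n.-tuple ('rV[R]_d * bool)%type).

Definition cell (x : 'rV[R]_d) : set 'rV[R]_d :=
  \bigcup_(j in [set j | A j x]) A j.

Definition hist_fun (x : 'rV[R]_d) : R :=
  n%:R^-1 * (\sum_(i < n) ((tnth D i).2 == true)%:R * \1_(cell x) (tnth D i).1)
  - n%:R^-1 *
    (\sum_(i < n) ((tnth D i).2 == false)%:R * \1_(cell x) (tnth D i).1).

Definition hist_rule (x : 'rV[R]_d) : R := sign (hist_fun x).

End histogram.

(* Constants and exponents. At alpha = +oo each expression below is the limit
   of the finite case as alpha tends to +oo. For gamma = 0, where some of them
   divide by 0, ctilde is 0, as is its limit as gamma tends to 0. *)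
Section constants.
Context (R : realType) (d : nat).
Variables (alpha : \bar R) (gamma cLC cME H : R).

Definition chat : R :=
  32 * Num.max (12 * H) 1 *
  Num.max 1
    (match alpha with
     | a%:E => (a + gamma) / gamma * cME `^ (a * gamma / (a + gamma)) *
               (gamma * cLC / a) `^ (a / (a + gamma))
     | _ => cME `^ gamma * cLC
     end).

Definition ctilde : R :=
  match alpha with
  | a%:E =>
      (16 * gamma * (a + 2 * gamma) * 8 ^+ d.+1 * Num.max cLC (2 `^ gamma) *
         (a + gamma)^-1
       / chat `^ ((a + gamma) / (a + 2 * gamma)))
      `^ ((a + gamma) / (a + gamma + gamma * (a + 2 * gamma)))
  | _ =>
      (16 * gamma * 8 ^+ d.+1 * Num.max cLC (2 `^ gamma) / chat)
      `^ (1 + gamma)^-1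
  end.

(* The recurring quantity (1 + gamma)(alpha + gamma) + gamma^2. *)
Definition kexp (a : R) : R := (1 + gamma) * (a + gamma) + gamma ^+ 2.

Definition exp_s_const : R :=
  match alpha with
  | a%:E => kexp a / (kexp a + d%:R * gamma)
  | _ => 1
  end.

Definition exp_s_sample : R :=
  match alpha with
  | a%:E => gamma / (kexp a + d%:R * gamma)
  | _ => 0
  end.

Definition exp_n : \bar R :=
  match alpha with
  | a%:E => (kexp a / gamma)%:E
  | _ => +oo%E
  end.

Definition exp_rate : R :=
  match alpha with
  | a%:E => (1 + gamma) * (a + gamma) / kexp a
  | _ => 1
  end.

End constants.

(* Main.v *)
Require Import Defs.
From HB Require Import structures.
From mathcomp Require Import all_boot all_order all_algebra.
From mathcomp Require Import all_classical all_reals all_analysis.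
From mathcomp Require Import measurable_realfun lra ring.

(* For each cell j write m_j and p_j for the integral of |2 eta - 1| over the
   cell and for its probability. A mixed cell, one that meets both X_1 and
   X_{-1}, lies in {Delta <= s}, so the mixed cells contribute at most the MNE
   term to the excess risk. On the other cells the sign of 2 eta - 1 is constant,
   and if the rule is wrong on all cells of a set B then the empirical mean of a
   {-1, 0, 1}-valued variable with mean m = m_B and second moment p = p_B is
   nonpositive, which has probability at most (1 - m^2 / (2 p))^n. A union bound
   over the subsets B of a family of K cells gives m^2 <= 2 p (tau + K) / n
   outside an event of probability e^-tau. It is applied to two families,
   separated by the distance r = ctilde (tau / (s^d n))^(gamma / kexp) from the
   decision boundary:
   - far cells: p <= c_LC r^-gamma m and K is of order s^-d;
   - near cells: p <= (c_ME u)^alpha + c_LC u^-gamma m for every u > 0, and the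
     volume bound at deltastar makes K of order r s^-d.
   The value of r balances the two bounds; the assumptions on s say that
   s <= r <= min (deltastar / 3) 1. For gamma = 0 they are contradictory, since
   ctilde = 0. *)

Set Implicit Arguments.
Unset Strict Implicit.
Unset Printing Implicit Defensive.

Import Order.TTheory GRing.Theory Num.Theory.
Import numFieldNormedType.Exports.

Local Open Scope classical_set_scope.
Local Open Scope ring_scope.

(** * Lower bounds for product measures *)

Section lower_integral.
Local Open Scope ereal_scope.
Context (disp : measure_display) (T : measurableType disp) (R : realType).
Implicit Types (mu : {measure set T -> \bar R}) (D E : set T) (f g : T -> \bar R).

(* The integral of a nonnegative function is a supremum over the simple
   functions below it, so monotonicity needs no measurability. *)
Lemma ge0_subset_le_integral mu D E f g :
  (forall x, D x -> 0 <= f x) -> (forall x, E x -> 0 <= g x) ->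
  (forall x, D x -> E x /\ f x <= g x) ->
  \int[mu]_(x in D) f x <= \int[mu]_(x in E) g x.
Proof.
move=> f0 g0 fg; rewrite !ge0_integralE//.
apply: ge_ereal_sup => _ [h /= hf <-]; apply: ereal_sup_ubound.
exists h => //= x; apply: (le_trans (hf x)); rewrite /patch.
case: ifPn => [/[!inE] /fg[Ex fgx]|_]; first by rewrite mem_set.
by case: ifPn => // /[!inE]; exact: g0.
Qed.

Lemma power_measure_ge0 mu n (G : set (n.-tuple T)) : 0 <= power_measure mu G.
Proof.
elim: n G => [|n IH] G /=; first by rewrite lee_fin.
by apply: integral_ge0 => x _; exact: IH.
Qed.

Lemma power_measure_mono mu n (G G' : set (n.-tuple T)) : G `<=` G' ->
  power_measure mu G <= power_measure mu G'.
Proof.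
elim: n G G' => [|n IH] G G' GG' /=.
  rewrite lee_fin !indicE ler_nat.
  by case: (boolP (_ \in G)) => // /[!inE] /GG' ?; rewrite mem_set.
apply: ge0_subset_le_integral => x _; [exact: power_measure_ge0..|].
by split=> //; apply: IH => t; exact: GG'.
Qed.

(** Integrating the first coordinate out of a finite sum of products leaves a sum of the same kind
    with new coefficients, which drives the induction on [n]. Being only a lower bound on the
    iterated integral, it covers arbitrary sets [G]. *)
Lemma power_measure_ge mu n (I : finType) (c : I -> R)
    (phi : I -> 'I_n -> T -> R) (G : set (n.-tuple T)) :
  (forall i k, mu.-integrable setT (EFin \o phi i k)) ->
  (forall D : n.-tuple T, (\sum_i c i * \prod_k phi i k (tnth D k) <= \1_G D)%R) ->
  (\sum_i c i * \prod_k fine (\int[mu]_x (phi i k x)%:E))%:E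
    <= power_measure mu G.
Proof.
elim: n c phi G => [|n IH] c phi G iphi le_G /=.
  rewrite lee_fin; apply: le_trans (le_G [tuple]).
  by apply: ler_sum => i _; rewrite !big_ord0.
(* [g x] is what remains of the sum once all coordinates but the first, which is held at [x], are
   integrated out. *)
pose a i := (\prod_(k < n) fine (\int[mu]_x (phi i (lift ord0 k) x)%:E))%R.
pose g x := (\sum_i c i * phi i ord0 x * a i)%R.
have ig : mu.-integrable setT (EFin \o g).
  rewrite (_ : EFin \o g = fun x => \sum_i (c i * a i)%:E * (phi i ord0 x)%:E).
    by apply: integrable_sum => // i _; apply: integrableZl => //; exact: iphi.
  apply/funext => x /=; rewrite /g -sumEFin; apply: eq_bigr => i _.
  by rewrite -EFinM mulrAC.
have -> : (\sum_i c i * \prod_k fine (\int[mu]_x (phi i k x)%:E))%:E =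
    \int[mu]_x (g x)%:E.
  under [RHS]eq_integral do rewrite /g -sumEFin.
  rewrite integral_sum//=; last first.
    move=> i; apply: (@eq_integrable _ _ _ _ _ measurableT
      (fun x => (c i * a i)%:E * (phi i ord0 x)%:E)).
      by move=> x _; rewrite -EFinM mulrAC.
    by apply: integrableZl => //; exact: iphi.
  rewrite -sumEFin; apply: eq_bigr => i _.
  under eq_integral do rewrite mulrAC EFinM.
  rewrite integralZl//; last exact: iphi.
  rewrite big_ord_recl -/(a i).
  have /(@integrable_fin_num _ _ _ _ _ measurableT) := iphi i ord0.
  move=> /fineK /= <-; rewrite -EFinM.
  by congr (_%:E); rewrite mulrA mulrAC.
(* [g] may be negative, while monotonicity is at hand for nonnegative integrands only. Its positive
   part still lies below the nonnegative [power_measure] of the sections. *)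
have /= le_pos : \int[mu]_x (g x)%:E <= \int[mu]_x (EFin \o g)^\+ x.
  apply: le_integral => //; first exact: integrable_funepos.
  by move=> x _ /=; rewrite funeposE le_max lexx.
apply: (le_trans le_pos); apply: ge0_subset_le_integral => [x _|x _|x _].
- by rewrite funeposE le_max lexx orbT.
- exact: power_measure_ge0.
split=> //; rewrite funeposE ge_max power_measure_ge0 andbT /=.
rewrite /g /a; apply: (IH (fun i => c i * phi i ord0 x)%R
   (fun i k => phi i (lift ord0 k))) => // D.
have := le_G [tuple of x :: D]; set S := (X in (X <= _)%R -> _).
rewrite !indicE /= (_ : _ \in G = (D \in [set t : n.-tuple T | G [tuple of x :: t]])); last first.
  by apply/idP/idP => /[!inE].
suff -> : S = (\sum_i c i * phi i ord0 x *
   \prod_k phi i (lift ord0 k) (tnth D k))%R by [].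
apply: eq_bigr => i _; rewrite big_ord_recl tnth0 mulrA; congr (_ * _)%R.
by apply: eq_bigr => k _; rewrite tnthS.
Qed.

End lower_integral.

(** * Measurability and distance to the decision boundary *)

Section rV_measurability.
Context (R : realType) (d : nat).
Implicit Types (x y z : 'rV[R]_d) (S U : set 'rV[R]_d) (s u : R).

Lemma measurable_coord (i : 'I_d) :
  measurable_fun setT (fun x : 'rV[R]_d => x ord0 i).
Proof.
move=> _ Y mY; rewrite setTI; apply: sub_sigma_algebra.
rewrite -bigcup_seq/=; exists i; first by rewrite /= mem_index_enum.
by exists Y => //; rewrite setTI.
Qed.

Lemma measurable_box (I : 'I_d -> interval R) :
  measurable [set x : 'rV[R]_d | forall i, x ord0 i \in I i].
Proof.
rewrite (_ : mkset _ =
    \bigcap_(i in [set: 'I_d]) ((fun x : 'rV_d => x ord0 i) @^-1` [set` I i])).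
  apply: fin_bigcap_measurable => // i _; rewrite -[X in measurable X]setTI.
  by apply: measurable_coord => //; exact: measurable_itv.
by apply/seteqP; split=> [x H i _|x H i]; [exact: H|exact: (H i Logic.I)].
Qed.

Lemma measurable_is_cube s S : is_cube s S -> measurable S.
Proof. by move=> [a [b [c ->]]]; exact: measurable_box. Qed.

Lemma measurable_domain : measurable (@domain R d).
Proof.
rewrite (_ : domain = [set x : 'rV[R]_d | forall i, x ord0 i \in `[-1, 1]]).
  exact: measurable_box.
by apply/seteqP; split=> x /= H i; have := H i; rewrite in_itv.
Qed.

Lemma mx_norm_leP x (e : R) : 0 <= e ->
  (forall i, `|x ord0 i| <= e) <-> `|x| <= e.
Proof.
move=> e0; rewrite -[`|x|]/(mx_norm x) mx_normrE; split => [H|H i].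
  by apply/bigmax_leP; split => // -[i j] _ /=; rewrite ord1.
by move/bigmax_leP : H => [_ /(_ (ord0, i))]; exact.
Qed.

(** An open set for the sup norm is the countable union of the boxes with rational centre and
    rational radius that it contains. *)
Lemma open_measurable_rV U : open U -> measurable U.
Proof.
move=> oU.
pose box (c : {ffun 'I_d -> rat} * rat) : set 'rV[R]_d :=
  [set x | forall i, x ord0 i \in
     `]ratr (c.1 i) - ratr c.2, ratr (c.1 i) + ratr c.2[ ].
rewrite (_ : U = \bigcup_(c in [set c | box c `<=` U]) box c).
  rewrite bigcup_mkcond; apply: countable_bigcupT_measurable => // c.
  by case: ifPn => // _; exact: measurable_box.
apply/seteqP; split=> [x Ux|x [c /= cU]]; last exact: cU.
have /nbhs_ballP[e /= e0 xeU] : nbhs x U by exact: open_nbhs_nbhs.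
(* A box of radius [r] that contains [x] lies in the ball of radius 2 r < e around [x]. *)
have /rat_in_itvoo[r] : 0 < e / 2 by rewrite divr_gt0.
rewrite in_itv /= => /andP[r0 re].
have H i : exists q : rat, `|x ord0 i - ratr q| < ratr r.
  have : x ord0 i - ratr r < x ord0 i + ratr r by lra.
  move=> /rat_in_itvoo[q]; rewrite in_itv/= => /andP[q1 q2].
  by exists q; rewrite ltr_norml; apply/andP; split; lra.
have [q qP] := choice H.
exists ([ffun i => q i], r) => [y /= yb|i /=].
  apply: xeU; split => // i' i; rewrite ord1 /ball /=.
  have := yb i; rewrite ffunE in_itv/= => /andP[y1 y2].
  have := qP i; rewrite !ltr_norml => /andP[q1 q2].
  by apply/andP; split; lra.
rewrite ffunE in_itv/=; have := qP i; rewrite ltr_norml => /andP[q1 q2].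
by apply/andP; split; lra.
Qed.

End rV_measurability.

Section distance.
Context (R : realType) (d : nat).
Implicit Types (x y z : 'rV[R]_d) (S U : set 'rV[R]_d) (s u : R).

Lemma set_dist_le S x y : S y -> (set_dist x S <= `|x - y|%:E)%E.
Proof. by move=> Sy; apply: ereal_inf_lbound; exists y. Qed.

Lemma set_dist_triangle S x y :
  (set_dist y S <= `|x - y|%:E + set_dist x S)%E.
Proof.
rewrite -leeBlDl//; apply: le_ereal_inf_tmp => _ [z Sz <-].
rewrite leeBlDl//; apply: (le_trans (set_dist_le y Sz)).
rewrite -EFinD lee_fin -[y - z](_ : (y - x) + (x - z) = _); last first.
  by rewrite addrA subrK.
by apply: (le_trans (ler_normD _ _)); rewrite distrC.
Qed.

Lemma set_dist_closure S x : closure S x -> (set_dist x S <= 0)%E.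
Proof.
move=> clS; apply/lee_addgt0Pr => e e0; rewrite add0e.
have [y [Sy]] := clS _ (nbhsx_ballx x e e0).
rewrite -ball_normE /ball_ /= => xye.
by apply: (le_trans (set_dist_le x Sy)); rewrite lee_fin ltW.
Qed.

Lemma open_set_dist_lt S u : open [set x | (set_dist x S < u%:E)%E].
Proof.
rewrite (_ : mkset _ = \bigcup_(y in S) ball y u).
  by apply: bigcup_open => y _; exact: ball_open.
apply/seteqP; split=> x /=.
  move=> /ereal_inf_lt[_ [y Sy <-]]; rewrite lte_fin => xyu; exists y => //.
  by rewrite -ball_normE /ball_ /= distrC.
move=> [y Sy]; rewrite -ball_normE /ball_ /= distrC => xyu.
by apply: (le_lt_trans (set_dist_le x Sy)); rewrite lte_fin.
Qed.

End distance.

Section margin.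
Context (R : realType) (d : nat) (eta : 'rV[R]_d -> R).
Implicit Types (x y z : 'rV[R]_d) (s u r : R).

Lemma Xposneg x : Xpos eta x -> Xneg eta x -> False.
Proof. by move=> [_ h1] [_ h2]; lra. Qed.

Lemma Delta_pos x : Xpos eta x -> Delta eta x = set_dist x (Xneg eta).
Proof.
move=> px; rewrite /Delta memNset ?mem_set//.
by move=> nx; exact: Xposneg px nx.
Qed.

Lemma Delta_neg x : Xneg eta x -> Delta eta x = set_dist x (Xpos eta).
Proof. by move=> px; rewrite /Delta mem_set. Qed.

Lemma Delta_zero x : eta x = 2^-1 -> Delta eta x = 0%E.
Proof.
by move=> ex; rewrite /Delta !memNset//= => -[_]; rewrite ex ltxx.
Qed.

Lemma eta_trichotomy {x} : domain x ->
  [\/ Xpos eta x, Xneg eta x | Xzero eta x].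
Proof.
move=> dx; case: (ltgtP 2^-1 (eta x)) => h.
- by apply: Or31.
- by apply: Or32.
- by apply: Or33.
Qed.

Lemma opposite_sides_Delta_le x y s : Xpos eta x -> Xneg eta y ->
  `|x - y| <= s -> (Delta eta x <= s%:E /\ Delta eta y <= s%:E)%E.
Proof.
move=> px ny xys; rewrite Delta_pos// Delta_neg//.
split; [apply: le_trans (set_dist_le _ ny) _|
        apply: le_trans (set_dist_le _ px) _]; rewrite lee_fin//.
by rewrite distrC.
Qed.

(** On the same side of the boundary this is the triangle inequality; on opposite sides [Delta] at
    [y] is at most the distance of the two points. If [x] is in [Xzero], the boundary hypotheses put
    it in the closure of both sides. *)
Lemma Delta_lipschitz x y r s :
  Xzero eta = rel_boundary (Xpos eta) -> Xzero eta = rel_boundary (Xneg eta) ->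
  domain x -> domain y -> 0 <= r -> `|x - y| <= s ->
  (Delta eta x <= r%:E)%E -> (Delta eta y <= (r + s)%:E)%E.
Proof.
move=> bpos bneg dx dy r0 xys dxr.
have s0 : 0 <= s by exact: le_trans xys.
have triangle S : (set_dist x S <= r%:E -> set_dist y S <= (r + s)%:E)%E.
  move=> xS; apply: (le_trans (set_dist_triangle S x y)).
  by rewrite addrC EFinD leeD// lee_fin.
have srs : (s%:E <= (r + s)%:E)%E by rewrite lee_fin; lra.
have [py|ny|[_ zy]] := eta_trichotomy dy; last first.
- by rewrite Delta_zero// lee_fin addr_ge0.
- have [px|nx|zx] := eta_trichotomy dx.
  + by apply: le_trans srs; have [] := opposite_sides_Delta_le px ny xys.
  + by rewrite Delta_neg//; apply: triangle; rewrite -Delta_neg.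
  + rewrite Delta_neg//; apply: triangle.
    have [[_ /set_dist_closure h] _] : rel_boundary (Xpos eta) x by rewrite -bpos.
    by apply: le_trans h _; rewrite lee_fin.
- have [px|nx|zx] := eta_trichotomy dx.
  + by rewrite Delta_pos//; apply: triangle; rewrite -Delta_pos.
  + rewrite distrC in xys.
    by apply: le_trans srs; have [] := opposite_sides_Delta_le py nx xys.
  + rewrite Delta_pos//; apply: triangle.
    have [[_ /set_dist_closure h] _] : rel_boundary (Xneg eta) x by rewrite -bneg.
    by apply: le_trans h _; rewrite lee_fin.
Qed.

Hypothesis meta : measurable_fun domain eta.

Lemma measurable_Xpos : measurable (Xpos eta).
Proof.
rewrite (_ : Xpos eta = domain `&` eta @^-1` `]2^-1, +oo[ ).
  by apply: meta => //; exact: measurable_domain.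
by apply/seteqP; split=> x /= [dx h]; split => //; move: h; rewrite in_itv/= andbT.
Qed.

Lemma measurable_Xneg : measurable (Xneg eta).
Proof.
rewrite (_ : Xneg eta = domain `&` eta @^-1` `]-oo, 2^-1[ ).
  by apply: meta => //; exact: measurable_domain.
by apply/seteqP; split=> x /= [dx h]; split => //; move: h; rewrite in_itv.
Qed.

Lemma measurable_Xzero : measurable (Xzero eta).
Proof.
rewrite (_ : Xzero eta = domain `\` (Xpos eta `|` Xneg eta)).
  apply: measurableD; first exact: measurable_domain.
  by apply: measurableU; [exact: measurable_Xpos|exact: measurable_Xneg].
apply/seteqP; split=> x /=.
  by move=> [dx ex]; split => // -[[_]|[_]]; rewrite ex ltxx.
by move=> [dx H]; have [?|?|//] := eta_trichotomy dx; case: H; [left|right].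
Qed.

(** On each side the condition is membership in an open set, and all of [Xzero] belongs to the set
    because [Delta] vanishes there. *)
Lemma measurable_Delta_lt u : 0 < u ->
  measurable [set x | domain x /\ (Delta eta x < u%:E)%E].
Proof.
move=> u0; rewrite (_ : mkset _ =
  (Xpos eta `&` [set x | (set_dist x (Xneg eta) < u%:E)%E]) `|`
  (Xneg eta `&` [set x | (set_dist x (Xpos eta) < u%:E)%E]) `|` Xzero eta).
  apply: measurableU; last exact: measurable_Xzero.
  apply: measurableU; apply: measurableI.
  - exact: measurable_Xpos.
  - by apply: open_measurable_rV; exact: open_set_dist_lt.
  - exact: measurable_Xneg.
  - by apply: open_measurable_rV; exact: open_set_dist_lt.
apply/seteqP; split=> x /=.
  move=> [dx]; have [px|nx|zx] := eta_trichotomy dx; last by right.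
  - by rewrite Delta_pos//; left; left.
  - by rewrite Delta_neg//; left; right.
move=> [[[px]|[nx]]|zx].
- by rewrite -Delta_pos//; split => //; case: px.
- by rewrite -Delta_neg//; split => //; case: nx.
- by case: zx => dx zx; rewrite Delta_zero.
Qed.

End margin.

(** * Excess risk as a noise mass *)

Section marginal_measure.
Local Open Scope ereal_scope.
Context (R : realType) (d : nat) (P : probability ('rV[R]_d * bool)%type R).

Let mfst : measurable_fun setT (fst : 'rV[R]_d * bool -> 'rV[R]_d).
Proof. exact: measurable_fst. Qed.

(** [marginal] is a bare set function; the measure axioms are transferred to it from this bundled
    pushforward. *)
Let pushforwardP : {measure set 'rV[R]_d -> \bar R} :=
  measure_function_pushforward__canonical__measure_function_Measure P mfst.

Let marginal0 : marginal P set0 = 0.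
Proof. exact: (measure0 pushforwardP). Qed.

Let marginal_ge0 A : 0 <= marginal P A.
Proof. exact: (measure_ge0 pushforwardP). Qed.

Let marginal_sigma_additive : semi_sigma_additive (marginal P).
Proof. exact: (@measure_semi_sigma_additive _ _ _ pushforwardP). Qed.

HB.instance Definition _ := isMeasure.Build _ _ _ (marginal P)
  marginal0 marginal_ge0 marginal_sigma_additive.

Let marginal_setT : marginal P setT = 1.
Proof. by rewrite /marginal /pushforward preimage_setT probability_setT. Qed.

HB.instance Definition _ :=
  Measure_isProbability.Build _ _ _ (marginal P) marginal_setT.

End marginal_measure.

Section posterior.
Local Open Scope ereal_scope.
Context (R : realType) (d : nat) (P : probability ('rV[R]_d * bool)%type R).
Variable eta : 'rV[R]_d -> R.
Hypothesis post : is_posterior P eta.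
Implicit Types (B E F : set 'rV[R]_d) (f g h : 'rV[R]_d -> R).

(** What misclassifying all of [E] adds to the Bayes risk. *)
Definition noise_mass E : \bar R :=
  \int[marginal P]_(x in E) `|2 * eta x - 1|%:E.

Lemma measurable_cross B b : measurable B -> measurable (B `*` [set b : bool]).
Proof. by move=> mB; exact: measurableX. Qed.

Lemma marginal_cross B : measurable B ->
  marginal P B = P (B `*` [set true]) + P (B `*` [set false]).
Proof.
move=> mB; rewrite -measureU; [|exact: measurable_cross..|].
  congr (P _); apply/seteqP; split=> -[x []] //=.
  - by move=> Bx; left.
  - by move=> Bx; right.
  - by move=> [] [].
  - by move=> [] [].
by apply/seteqP; split=> // -[x []] /= [[_ ?] [_ ?]].
Qed.

Lemma measurable_eta : measurable_fun domain eta. Proof. by case: post. Qed.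

Lemma eta01 x : domain x -> (0 <= eta x <= 1)%R.
Proof. by case: post => _ + _; exact. Qed.

Lemma measurable_eta_sub B : measurable B -> B `<=` domain ->
  measurable_fun B eta.
Proof.
move=> mB Bd; apply: measurable_funS measurable_eta => //.
exact: measurable_domain.
Qed.

Lemma measurable_noise B : measurable B -> B `<=` domain ->
  measurable_fun B (fun x => `|2 * eta x - 1|%:E : \bar R).
Proof.
move=> mB Bd; apply/measurable_EFinP; apply: measurableT_comp => //.
apply: measurable_funB => //; apply: measurable_funM => //.
exact: measurable_eta_sub.
Qed.

Lemma noise_mass_ge0 E : 0 <= noise_mass E.
Proof. by apply: integral_ge0 => x _; rewrite lee_fin. Qed.

Lemma noise_mass_mono B E : B `<=` E -> noise_mass B <= noise_mass E.
Proof.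
move=> BE; apply: ge0_subset_le_integral => x.
- by rewrite lee_fin.
- by rewrite lee_fin.
- by move=> /BE.
Qed.

Lemma noise_mass_setU B E : measurable B -> measurable E ->
  B `<=` domain -> E `<=` domain -> B `&` E = set0 ->
  noise_mass (B `|` E) = noise_mass B + noise_mass E.
Proof.
move=> mB mE Bd Ed BE; rewrite /noise_mass ge0_integral_setU//=.
- apply: measurable_noise; first exact: measurableU.
  by rewrite subUset.
- exact/disj_set2P.
Qed.

Lemma noise_massU B E : measurable B -> measurable E ->
  B `<=` domain -> E `<=` domain ->
  noise_mass (B `|` E) <= noise_mass B + noise_mass E.
Proof.
move=> mB mE Bd Ed.
have -> : B `|` E = B `|` (E `\` B).
  apply/seteqP; split=> x [Bx|]; [by left| |by left|by move=> []; right].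
  by move=> Ex; have [Bx|Bx] := pselect (B x); [left|right].
rewrite noise_mass_setU//.
- by rewrite leeD//; apply: noise_mass_mono; exact: subDsetl.
- exact: measurableD.
- by move=> x [/Ed].
- by apply/seteqP; split=> // x [Bx []].
Qed.

Lemma posterior_true B : measurable B -> B `<=` domain ->
  P (B `*` [set true]) = \int[marginal P]_(x in B) (eta x)%:E.
Proof. by case: post => _ _; exact. Qed.

(** The integrals of [eta] and 1 - [eta] add up to the marginal of [B]; the finite mass carrying
    label 1 is then cancelled. *)
Lemma posterior_false B : measurable B -> B `<=` domain ->
  P (B `*` [set false]) = \int[marginal P]_(x in B) (1 - eta x)%:E.
Proof.
move=> mB Bd.
have e01 x : B x -> (0 <= eta x <= 1)%R by move=> /Bd; exact: eta01.
have h : marginal P B = \int[marginal P]_(x in B) (eta x)%:E +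
    \int[marginal P]_(x in B) (1 - eta x)%:E.
  rewrite -ge0_integralD//.
  - under eq_integral do rewrite -EFinD addrC subrK.
    by rewrite integral_cst// mul1e.
  - by move=> x /e01/andP[]; rewrite lee_fin.
  - by apply/measurable_EFinP; exact: measurable_eta_sub.
  - by move=> x /e01/andP[]; rewrite lee_fin subr_ge0.
  - apply/measurable_EFinP; apply: measurable_funB => //.
    exact: measurable_eta_sub.
have fint : P (B `*` [set true]) \is a fin_num.
  by apply: fin_num_measure; exact: measurable_cross.
rewrite marginal_cross// -posterior_true// in h.
by rewrite -[LHS](addeK _ fint) [X in X - _]addeC h [X in X - _]addeC addeK.
Qed.

(** Pointwise, eta = (1 - eta) + |2 eta - 1| as soon as eta >= 1/2. *)
Lemma noise_mass_pos B : measurable B -> B `<=` domain ->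
  (forall x, B x -> (2^-1 <= eta x)%R) ->
  P (B `*` [set true]) = P (B `*` [set false]) + noise_mass B.
Proof.
move=> mB Bd Bpos; rewrite posterior_true// posterior_false// -ge0_integralD//.
- apply: eq_integral => x /[!inE] Bx; rewrite -EFinD; congr _%:E.
  by rewrite ger0_norm; have := Bpos _ Bx; lra.
- by move=> x /Bd/eta01/andP[]; rewrite lee_fin subr_ge0.
- apply/measurable_EFinP; apply: measurable_funB => //.
  exact: measurable_eta_sub.
- exact: measurable_noise.
Qed.

Lemma noise_mass_neg B : measurable B -> B `<=` domain ->
  (forall x, B x -> (eta x <= 2^-1)%R) ->
  P (B `*` [set false]) = P (B `*` [set true]) + noise_mass B.
Proof.
move=> mB Bd Bneg; rewrite posterior_true// posterior_false// -ge0_integralD//.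
- apply: eq_integral => x /[!inE] Bx; rewrite -EFinD; congr _%:E.
  by rewrite ler0_norm; have := Bneg _ Bx; lra.
- by move=> x /Bd/eta01/andP[]; rewrite lee_fin.
- by apply/measurable_EFinP; exact: measurable_eta_sub.
- exact: measurable_noise.
Qed.

(** The conditional risk at [x] of the classifier that predicts -1 on [F] and 1 elsewhere. *)
Definition loss_density F x : R :=
  (eta x * \1_F x + (1 - eta x) * (1 - \1_F x))%R.

Lemma loss_density_ge0 F x : domain x -> (0 <= loss_density F x)%R.
Proof.
move=> /eta01/andP[e0 e1]; rewrite /loss_density indicE.
by case: (x \in F); rewrite /= ?mulr1n ?mulr0n; lra.
Qed.

Lemma measurable_loss_density F : measurable F ->
  measurable_fun domain (EFin \o loss_density F).
Proof.
move=> mF; apply/measurable_EFinP; apply: measurable_funD.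
- apply: measurable_funM; first exact: measurable_eta.
  exact: measurable_indic.
- apply: measurable_funM; apply: measurable_funB => //.
    exact: measurable_eta.
Qed.

Lemma integral_mul_indic (g : 'rV[R]_d -> R) B F : F `<=` B ->
  \int[marginal P]_(x in B) (g x * \1_F x)%:E = \int[marginal P]_(x in F) (g x)%:E.
Proof.
move=> FB; rewrite -[in RHS](setIidr FB) integral_mkcondr.
apply: eq_integral => x _; rewrite /patch indicE.
by case: ifPn => // _; rewrite ?mulr1 ?mulr0.
Qed.

Lemma risk_loss_density f : measurable_fun domain f ->
  risk P f = \int[marginal P]_(x in domain)
    (loss_density (domain `&` [set x | (f x < 0)%R]) x)%:E.
Proof.
move=> mf; set F := domain `&` _.
have mD : measurable (@domain R d) := @measurable_domain R d.
have mF : measurable F.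
  rewrite (_ : F = domain `&` f @^-1` `]-oo, 0%R[ ); first exact: mf.
  by apply/seteqP; split=> x /=; rewrite in_itv.
have mDF : measurable (domain `\` F) by exact: measurableD.
have FD : F `<=` domain by move=> x [].
have DFD : domain `\` F `<=` domain by exact: subDsetl.
(* The loss is the indicator of a wrong prediction: label 1 where f < 0, or label -1 where f >=
   0. *)
transitivity (P (F `*` [set true]) + P ((domain `\` F) `*` [set false])).
  rewrite -measureU; [|exact: measurable_cross..|]; last first.
    by apply/seteqP; split=> // -[x []] /= [[_ ?] [_ ?]].
  set N := _ `|` _.
  have mN : measurable N by apply: measurableU; exact: measurable_cross.
  transitivity (P (N `&` (domain `*` setT))); last first.
    congr (P _); apply/setIidPl => -[x b].
    by rewrite /N /= => -[[/FD]|[/DFD]].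
  have mDT : measurable (@domain R d `*` [set: bool]) by exact: measurableX.
  rewrite -integral_indic//; apply: eq_integral => -[x b] /[!inE] -[/= dx _].
  congr _%:E; rewrite /class_loss /sign /label indicE /=.
  have [fx|fx] := leP 0%R (f x); case: b => /=;
    rewrite ?mulN1r ?mul1r ?opprK ?ler10 ?lerN10 -?mulN1r.
  - rewrite memNset// /N /= => -[[[_ /=]]|[[_ _]//]].
    by rewrite ltNge fx.
  - by rewrite mem_set// /N /=; right; split => //; split => // -[_ /=]; rewrite ltNge fx.
  - by rewrite mem_set// /N /=; left.
  - by rewrite memNset// /N /= => -[[]//|[[_ +] _]]; apply.
rewrite posterior_true// posterior_false//.
rewrite -(integral_mul_indic eta FD) -(integral_mul_indic _ DFD) -ge0_integralD//.
- apply: eq_integral => x /[!inE] dx; rewrite -EFinD; congr _%:E.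
  rewrite /loss_density !indicE in_setD (mem_set dx) /=.
  by case: (x \in F); rewrite /= ?mulr1n ?mulr0n; lra.
- by move=> x /eta01/andP[e0 _]; rewrite lee_fin mulr_ge0.
- apply/measurable_EFinP; apply: measurable_funM; first exact: measurable_eta.
  exact: measurable_indic.
- by move=> x /eta01/andP[_ e1]; rewrite lee_fin mulr_ge0// subr_ge0.
- apply/measurable_EFinP; apply: measurable_funM; last exact: measurable_indic.
  by apply: measurable_funB => //; exact: measurable_eta.
Qed.

(** Points of [Xzero] are left out, as both predictions are optimal there. The value 0 of [f] counts
    as the prediction 1, as in [sign]. *)
Definition error_set f : set 'rV[R]_d :=
  (Xpos eta `&` [set x | (f x < 0)%R]) `|` (Xneg eta `&` [set x | (0 <= f x)%R]).

Lemma measurable_error_set f : measurable_fun domain f ->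
  measurable (error_set f).
Proof.
move=> mf.
have mD : measurable (@domain R d) := @measurable_domain R d.
have mF : measurable (domain `&` [set x | (f x < 0)%R]).
  rewrite (_ : _ `&` _ = domain `&` f @^-1` `]-oo, 0%R[ ); first exact: mf.
  by apply/seteqP; split=> x /=; rewrite in_itv.
have mF' : measurable (domain `&` [set x | (0 <= f x)%R]).
  rewrite (_ : _ `&` _ = domain `&` f @^-1` `[0%R, +oo[ ); first exact: mf.
  by apply/seteqP; split=> x /=; rewrite in_itv/= andbT.
rewrite (_ : error_set f = (Xpos eta `&` (domain `&` [set x | (f x < 0)%R])) `|`
    (Xneg eta `&` (domain `&` [set x | (0 <= f x)%R]))).
  apply: measurableU; apply: measurableI => //.
    by apply: measurable_Xpos; exact: measurable_eta.
  by apply: measurable_Xneg; exact: measurable_eta.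
by apply/seteqP; split=> x /=;
  [move=> [[[]]|[[]]]; [left|right]|move=> [[? [? ?]]|[? [? ?]]]; [left|right]].
Qed.

Lemma error_set_domain f : error_set f `<=` domain.
Proof. by move=> x [[[]]|[[]]]. Qed.

(** Off its error set, [h] attains the least conditional risk min(eta, 1 - eta); on it, [h] exceeds
    this minimum by |2 eta - 1|. The comparison with [f] is thus pointwise. *)
Lemma risk_le f h : measurable_fun domain f -> measurable_fun domain h ->
  risk P h <= risk P f + noise_mass (error_set h).
Proof.
move=> mf mh; rewrite !risk_loss_density//.
have mD : measurable (@domain R d) := @measurable_domain R d.
have mF (g : 'rV[R]_d -> R) : measurable_fun domain g ->
    measurable (domain `&` [set x | (g x < 0)%R]).
  move=> mg.
  rewrite (_ : _ `&` _ = domain `&` g @^-1` `]-oo, 0%R[ ); first exact: mg.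
  by apply/seteqP; split=> x /=; rewrite in_itv.
have ED := @error_set_domain h; have mE := measurable_error_set mh.
rewrite /noise_mass -(integral_mul_indic _ ED) -ge0_integralD//.
- apply: ge0_le_integral => //.
  + by move=> x dx; rewrite lee_fin loss_density_ge0.
  + by apply: measurable_loss_density; exact: mF.
  + apply: emeasurable_funD; first by apply: measurable_loss_density; exact: mF.
    apply/measurable_EFinP; apply: measurable_funM; last exact: measurable_indic.
    by have /measurable_EFinP := @measurable_noise domain mD (@subset_refl _ _).
  + move=> x dx; rewrite -EFinD lee_fin /loss_density !indicE !in_setI.
    rewrite (mem_set dx) /=.
    have e01 := eta01 dx.
    have -> : (x \in [set x | (h x < 0)%R]) = (h x < 0)%R by apply/idP/idP; rewrite inE.
    have -> : (x \in [set x | (f x < 0)%R]) = (f x < 0)%R by apply/idP/idP; rewrite inE.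
    have [px|nx|[_ zx]] := eta_trichotomy eta dx.
    * have -> : (x \in error_set h) = (h x < 0)%R.
        apply/idP/idP; rewrite inE; first by move=> [[]//|[nx]]; case: (Xposneg px nx).
        by left.
      case: px => _ px; rewrite gtr0_norm; last lra.
      by case: (h x < 0)%R; case: (f x < 0)%R; rewrite /= ?mulr1n ?mulr0n; lra.
    * have -> : (x \in error_set h) = ~~ (h x < 0)%R.
        rewrite -leNgt; apply/idP/idP; rewrite inE; last by right.
        by move=> [[px]|[]//]; case: (Xposneg px nx).
      case: nx => _ nx; rewrite ltr0_norm; last lra.
      by case: (h x < 0)%R; case: (f x < 0)%R; rewrite /= ?mulr1n ?mulr0n; lra.
    * rewrite zx (_ : 2 * 2^-1 - 1 = 0)%R ?normr0 ?mul0r; last lra.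
      by case: (h x < 0)%R; case: (f x < 0)%R; rewrite /= ?mulr1n ?mulr0n; lra.
- by move=> x dx; rewrite lee_fin loss_density_ge0.
- by apply: measurable_loss_density; exact: mF.
- apply/measurable_EFinP; apply: measurable_funM; last exact: measurable_indic.
  by have /measurable_EFinP := @measurable_noise domain mD (@subset_refl _ _).
Qed.

Lemma noise_mass_le_marginal B : measurable B -> B `<=` domain ->
  noise_mass B <= marginal P B.
Proof.
move=> mB Bd; rewrite -[leRHS]mul1e -integral_cst//.
apply: ge0_le_integral => //; first exact: measurable_noise.
move=> x /Bd/eta01 e01; rewrite lee_fin ler_norml; lra.
Qed.

Lemma noise_mass_fin B : measurable B -> B `<=` domain ->
  noise_mass B \is a fin_num.
Proof.
move=> mB Bd; rewrite ge0_fin_numE ?noise_mass_ge0//.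
apply: (le_lt_trans (noise_mass_le_marginal mB Bd)).
by rewrite ltey_eq fin_num_measure.
Qed.

Lemma excess_risk_le h : measurable_fun domain h ->
  risk P h - bayes_risk P <= noise_mass (error_set h).
Proof.
move=> mh; set M := noise_mass _.
have Mfin : M \is a fin_num.
  by apply: noise_mass_fin; [exact: measurable_error_set|exact: error_set_domain].
have lb : risk P h - M <= bayes_risk P.
  apply: le_ereal_inf_tmp => _ [f /= mf <-].
  by rewrite leeBlDr// risk_le.
have risk_ge0 f : 0 <= risk P f.
  by apply: integral_ge0 => z _; rewrite lee_fin.
(* Moving [bayes_risk] across the inequality of extended reals requires it to be finite: it lies
   between 0 and the risk of [h]. *)
have bfin : bayes_risk P \is a fin_num.
  rewrite fin_numE; apply/andP; split.
    rewrite gt_eqF//; apply: (@lt_le_trans _ _ 0) => //.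
    by apply: le_ereal_inf_tmp => _ [f /= _ <-].
  rewrite lt_eqF//; apply: (@le_lt_trans _ _ (risk P h)).
    by apply: ereal_inf_lbound; exists h.
  apply: (@le_lt_trans _ _ (P (domain `*` setT))); last first.
    rewrite ltey_eq fin_num_measure//.
    by apply: measurableX => //; exact: measurable_domain.
  rewrite -[leRHS]mul1e -integral_cst//.
    apply: ge0_subset_le_integral => z dz; rewrite ?lee_fin ?ler01//.
    by split=> //; rewrite /class_loss lern1 leq_b1.
  by apply: measurableX => //; exact: measurable_domain.
by rewrite leeBlDr// addeC -leeBlDr.
Qed.

End posterior.

(** * Chernoff and union bound *)

Section chernoff.
Context (disp : measure_display) (T : measurableType disp) (R : realType).
Implicit Types (S : set T) (t : R).

(* On disjoint S and S' this is (1 + t) ^ (1_S' - 1_S). *)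
Definition chernoff_weight t S S' (z : T) : R :=
  1 + t * \1_S' z + ((1 + t)^-1 - 1) * \1_S z.

(** Each factor is 1 + t on [S'], its inverse on [S] and 1 elsewhere, so the product is 1 + t raised
    to the difference of the two counts. *)
Lemma prod_chernoff_weight_ge1 t S S' n (D : n.-tuple T) : 0 <= t ->
  S `&` S' = set0 ->
  (\sum_(i < n) (tnth D i \in S) <= \sum_(i < n) (tnth D i \in S'))%N ->
  1 <= \prod_(i < n) chernoff_weight t S S' (tnth D i).
Proof.
move=> t0 disj le_cnt.
have t1 : 0 < 1 + t by lra.
have -> : \prod_(i < n) chernoff_weight t S S' (tnth D i) =
    (1 + t) ^+ (\sum_(i < n) (tnth D i \in S')) /
    (1 + t) ^+ (\sum_(i < n) (tnth D i \in S)).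
  rewrite -!prodrXr -prodfV -big_split /=; apply: eq_bigr => i _.
  rewrite /chernoff_weight !indicE.
  case: (boolP (_ \in S)) => [/[!inE] iS|_]; last first.
    by case: (_ \in S'); rewrite /= ?expr1 ?expr0; field; rewrite gt_eqF.
  rewrite memNset; last by move=> iS'; have : set0 (tnth D i) by rewrite -disj.
  by rewrite /= ?expr1 ?expr0; field; rewrite gt_eqF.
by rewrite ler_pdivlMr ?exprn_gt0// mul1r ler_weXn2l//; lra.
Qed.

Variable P : probability T R.

Lemma integrable_indicP S : measurable S -> P.-integrable setT (EFin \o \1_S).
Proof.
by move=> mS; apply: integrable_indic => //; rewrite setIT ltey_eq fin_num_measure.
Qed.

Lemma chernoff_weight_integrable t S S' : measurable S -> measurable S' ->
  P.-integrable setT (EFin \o chernoff_weight t S S').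
Proof.
move=> mS mS'.
have -> : EFin \o chernoff_weight t S S' = (cst 1 \+
   (fun z => t%:E * (EFin \o \1_S') z) \+
   (fun z => ((1 + t)^-1 - 1)%:E * (EFin \o \1_S) z))%E by apply/funext.
apply: integrableD => //; last by apply: integrableZl => //; exact: integrable_indicP.
apply: integrableD => //; last by apply: integrableZl => //; exact: integrable_indicP.
exact: finite_measure_integrable_cst.
Qed.

Lemma integral_chernoff_weight t S S' : measurable S -> measurable S' ->
  (\int[P]_z (chernoff_weight t S S' z)%:E =
   (1 + t * fine (P S') + ((1 + t)^-1 - 1) * fine (P S))%:E)%E.
Proof.
move=> mS mS'.
have iS k U : measurable U -> P.-integrable setT (fun z => k%:E * (EFin \o \1_U) z)%E.
  by move=> mU; apply: integrableZl => //; exact: integrable_indicP.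
have i1 : P.-integrable setT (cst 1%E) by exact: finite_measure_integrable_cst.
have iU k U : measurable U ->
    (\int[P]_z (k%:E * (EFin \o \1_U) z) = (k * fine (P U))%:E)%E.
  move=> mU; rewrite integralZl//; last exact: integrable_indicP.
  by rewrite integral_indic// setIT EFinM fineK// fin_num_measure.
transitivity (\int[P]_z ((cst 1 \+ (fun z => t%:E * (EFin \o \1_S') z)) z +
   ((1 + t)^-1 - 1)%:E * (EFin \o \1_S) z))%E; first by [].
rewrite integralD//; [|by apply: integrableD => //; exact: iS|exact: iS].
rewrite iU// integralD//; last exact: iS.
rewrite iU// integral_cst// mul1e.
by rewrite [X in (X + _ + _)%E](_ : _ = 1%E)//; exact: probability_setT.
Qed.

(** For t = M / p the integral has the closed form 1 - M^2 / (2 p), which is nonnegative and at most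
    1 - L <= exp(-L). *)
Lemma integral_chernoff_weight_le S S' (L : R) :
  measurable S -> measurable S' ->
  let M := fine (P S) - fine (P S') in
  let p := fine (P S) + fine (P S') in
  0 <= L -> 0 <= M -> 2 * p * L < M ^+ 2 ->
  0 <= fine (\int[P]_z (chernoff_weight (M / p) S S' z)%:E) <= expR (- L).
Proof.
move=> mS mS' M p L0 M0 pLM.
have P0 : 0 <= fine (P S') by exact: fine_ge0.
have Mp : M <= p by rewrite /M /p; lra.
have pL0 : 0 <= 2 * p * L by rewrite mulr_ge0//; lra.
(* The strict inequality in the hypothesis rules out M = 0, hence also p = 0 in the quotient M /
   p. *)
have {}M0 : 0 < M.
  rewrite lt_neqAle M0 andbT; apply/eqP => M00.
  by move: pLM; rewrite -M00 expr0n/=; lra.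
have p0 : 0 < p by lra.
have M1 : M <= 1.
  have : (P S <= 1)%E by exact: probability_le1.
  rewrite -(@fineK _ (P S)) ?fin_num_measure// lee_fin.
  by rewrite /M; lra.
rewrite integral_chernoff_weight//=.
have -> : 1 + M / p * fine (P S') + ((1 + M / p)^-1 - 1) * fine (P S) =
    1 - M ^+ 2 / (2 * p).
  have -> : fine (P S) = (p + M) / 2 by rewrite /p /M; lra.
  have -> : fine (P S') = (p - M) / 2 by rewrite /p /M; lra.
  by field; rewrite !gt_eqF//; lra.
apply/andP; split.
  rewrite subr_ge0 ler_pdivrMr; last lra.
  rewrite expr2; apply: (@le_trans _ _ (1 * p)); last lra.
  by apply: ler_pM => //; lra.
apply: (@le_trans _ _ (1 - L)).
  by rewrite lerD2l lerN2 ler_pdivlMr ?mulr_gt0// mulrC ltW.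
exact: expR_ge1Dx.
Qed.

(* Chernoff's bound for the sums of 1_(S i) - 1_(S' i) and a union bound over
   i : by Markov's inequality the complement of G has probability at most the
   integral of the sum over i of the products of the weights. *)
Lemma power_measure_chernoff n (I : finType) (F : pred I) (S S' : I -> set T)
    (L : I -> R) (G : set (n.-tuple T)) :
  (forall i, measurable (S i)) -> (forall i, measurable (S' i)) ->
  (forall i, S i `&` S' i = set0) ->
  (forall i, F i ->
    let M := fine (P (S i)) - fine (P (S' i)) in
    let p := fine (P (S i)) + fine (P (S' i)) in
    [/\ 0 <= L i, 0 <= M & 2 * p * L i < M ^+ 2]) ->
  (forall D : n.-tuple T, ~ G D -> exists2 i, F i &
    (\sum_(k < n) (tnth D k \in S i) <= \sum_(k < n) (tnth D k \in S' i))%N) ->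
  ((1 - \sum_(i | F i) expR (- (n%:R * L i)))%:E <= power_measure P G)%E.
Proof.
move=> mS mS' disj cond GP.
pose t i := (fine (P (S i)) - fine (P (S' i))) / (fine (P (S i)) + fine (P (S' i))).
have t0 i : F i -> 0 <= t i.
  move=> /cond /= [_ M0 _]; apply: divr_ge0 => //.
  by rewrite addr_ge0// fine_ge0.
(* The minorant of the indicator of [G] is 1 minus the sum over [F] of the products of weights. The
   left part of the sum type indexes the constant 1. *)
pose c (j : 'I_1 + I) : R :=
  match j with inl _ => 1 | inr i => if F i then -1 else 0 end.
pose phi (j : 'I_1 + I) (k : 'I_n) : T -> R :=
  match j with inl _ => cst 1
  | inr i => if F i then chernoff_weight (t i) (S i) (S' i) else cst 0 end.
have := @power_measure_ge _ T R P n ('I_1 + I)%type c phi G.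
rewrite big_sumType big_ord1 /= => H.
have {H} : ((1 * \prod_(k < n) fine (\int[P]_x (1%R)%:E) +
   \sum_i (if F i then -1 else 0) * \prod_(k < n) fine (\int[P]_x
   ((if F i then chernoff_weight (t i) (S i) (S' i) else cst 0) x)%:E))%:E
   <= power_measure P G)%E.
  apply: H => [[i|i] k|D].
  - exact: finite_measure_integrable_cst.
  - rewrite /phi; case: ifP => Fi; first exact: chernoff_weight_integrable.
    exact: finite_measure_integrable_cst.
  rewrite big_sumType big_ord1 /= big1 ?mul1r//.
  have w0 i k : F i -> 0 <= chernoff_weight (t i) (S i) (S' i) (tnth D k).
    move=> /t0 ti; rewrite /chernoff_weight !indicE.
    have ti1 : 0 < (1 + t i)^-1 by rewrite invr_gt0; lra.
    by case: (_ \in S i); case: (_ \in S' i); rewrite /= ?mulr1n ?mulr0n; lra.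
  have le0 i : (if F i then -1 else 0) * \prod_k
     (if F i then chernoff_weight (t i) (S i) (S' i) else cst 0) (tnth D k) <= 0.
    case: ifP => Fi; last by rewrite mul0r.
    by rewrite mulN1r oppr_le0; apply: prodr_ge0 => k _; exact: w0.
  rewrite indicE; case: (boolP (D \in G)) => [_|].
    rewrite /= ?mulr1n -[leRHS]addr0 lerD2l.
    by apply: sumr_le0 => i _; exact: le0.
  (* Off [G] some product is at least 1 and cancels the constant; the other products only decrease
     the sum. *)
  move=> /negP; rewrite inE => /GP[i Fi cnt] /=.
  rewrite (bigD1 i) //= Fi mulN1r addrA.
  have := prod_chernoff_weight_ge1 (t0 i Fi) (disj i) cnt.
  set pr := \prod_(_ < n) _ => pr1.
  have : \sum_(j | j != i) (if F j then -1 else 0) * \prod_k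
     (if F j then chernoff_weight (t j) (S j) (S' j) else cst 0) (tnth D k) <= 0.
    by apply: sumr_le0 => j _; exact: le0.
  by rewrite mulr0n; lra.
have int1 : (\int[P]_x (1%R)%:E = 1)%E.
  by rewrite integral_cst// mul1e; exact: probability_setT.
apply: le_trans; rewrite lee_fin int1 /=.
rewrite mul1r [X in _ <= X + _]big1// lerD2l [leRHS](bigID F)/= [X in _ + X]big1 ?addr0; last first.
  by move=> i /negbTE ->; rewrite mul0r.
rewrite -sumrN; apply: ler_sum => i Fi; rewrite Fi mulN1r lerN2.
rewrite prodr_const card_ord; have [L0 M0 pLM] := cond i Fi.
have /andP[w0 w1] := integral_chernoff_weight_le (mS i) (mS' i) L0 M0 pLM.
rewrite -mulrN expRM_natl.
by rewrite lerXn2r ?nnegrE// expR_ge0.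
Qed.

End chernoff.

(** * Cells of the partition *)

Lemma in_cross (T : Type) (B : set T) (b : bool) (z : T * bool) :
  (z \in B `*` [set b]) = (z.2 == b) && (z.1 \in B).
Proof.
apply/idP/andP => [/set_mem[Bz zb]|[/eqP zb /set_mem Bz]].
  by split; [exact/eqP|exact: mem_set].
by apply: mem_set; split.
Qed.

Section cells.
Context (R : realType) (d : nat) (s : R) (A : nat -> set 'rV[R]_d).
Hypothesis cpA : cubic_partition s A.
Implicit Types (x y z : 'rV[R]_d) (j : nat).

Lemma measurable_cell j : measurable (A j).
Proof. by case: cpA => + _ _; move/(_ j); exact: measurable_is_cube. Qed.

Lemma cell_inj j k x : A j x -> A k x -> j = k.
Proof. by case: cpA => _ tA _ Aj Ak; apply: tA => //; exists x. Qed.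

Lemma cellE j x : A j x -> cell A x = A j.
Proof.
move=> Ajx; apply/seteqP; split=> [y [k /= Akx]|y Ajy].
  by rewrite (cell_inj Akx Ajx).
by exists j.
Qed.

Lemma cell_dist j x y : 0 <= s -> A j x -> A j y -> `|x - y| <= s.
Proof.
case: cpA => /(_ j)[a [b [c ->]]] _ _ s0 /= Ax Ay.
apply/(mx_norm_leP _ s0) => i; rewrite !mxE.
have h (z : R) : z \in Interval (BSide (b i) (a ord0 i)) (BSide (c i) (a ord0 i + s)) ->
    a ord0 i <= z <= a ord0 i + s.
  by rewrite itv_boundlr /= => /andP[]; case: (b i); case: (c i); rewrite !bnd_simp;
    move=> ? ?; apply/andP; split=> //; exact: ltW.
have /andP[? ?] := h _ (Ax i); have /andP[? ?] := h _ (Ay i).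
by rewrite ler_norml; apply/andP; split; lra.
Qed.

Variable (n : nat) (D : n.-tuple ('rV[R]_d * bool)).

Definition cell_count j (b : bool) : nat :=
  (\sum_(i < n) (tnth D i \in A j `*` [set b]))%N.

Lemma hist_fun_cell j x : A j x -> hist_fun A D x =
  n%:R^-1 * ((cell_count j true)%:R - (cell_count j false)%:R).
Proof.
move=> Ajx; rewrite /hist_fun (cellE Ajx) /cell_count !natr_sum mulrBr.
by congr (_ * _ - _ * _); apply: eq_bigr => i _;
  rewrite indicE -natrM mulnb in_cross.
Qed.

(** A tie is decided in favour of 1, like [sign] at 0. *)
Definition cell_sign j : R :=
  if (cell_count j false <= cell_count j true)%N then 1 else -1.

Lemma hist_rule_cell j x : (0 < n)%N -> A j x -> hist_rule A D x = cell_sign j.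
Proof.
move=> n0 Ajx; rewrite /hist_rule /sign (hist_fun_cell Ajx) /cell_sign.
by rewrite pmulr_rge0 ?invr_gt0 ?ltr0n// subr_ge0 ler_nat.
Qed.

(** The rule is constant on cells, so every preimage is a countable union of cells. *)
Lemma measurable_hist_rule B : (0 < n)%N -> measurable_fun B (hist_rule A D).
Proof.
move=> n0 mB Y mY; apply: measurableI => //.
rewrite (_ : _ @^-1` _ = \bigcup_(j in [set j | Y (cell_sign j)]) A j).
  by apply: bigcup_measurable => j _; exact: measurable_cell.
apply/seteqP; split=> [x /= Yx|x [j /= Yj Ajx]]; last first.
  by rewrite /preimage /= (hist_rule_cell n0 Ajx).
have [j _ Ajx] : (\bigcup_j A j) x by case: cpA => _ _ ->.
by exists j => //=; rewrite -(hist_rule_cell n0 Ajx).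
Qed.

End cells.

(** * Pure cells: mean and second moment of the signed label *)

Section pure_cells.
Context (R : realType) (d : nat) (P : probability ('rV[R]_d * bool)%type R).
Variables (eta : 'rV[R]_d -> R) (s : R) (A : nat -> set 'rV[R]_d) (N : nat).
Hypothesis PD : P (domain `*` setT) = 1%E.
Hypothesis post : is_posterior P eta.
Hypothesis cpA : cubic_partition s A.
Implicit Types (B J : {set 'I_N}) (e : nat -> bool).

(** On a pure cell this is the optimal label. It is [true] by convention if the cell meets neither
    [Xpos] nor [Xneg]. *)
Definition cell_label j : bool := `[< A j `&` Xneg eta = set0 >].

Definition pure_cell j : bool :=
  cell_label j || `[< A j `&` Xpos eta = set0 >].

Definition cell_union B : set 'rV[R]_d := \bigcup_(j in [set` B]) A j.

Definition region B : set 'rV[R]_d := domain `&` cell_union B.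

(** For [e] = [cell_label] these are the observations in [B] with the optimal label of their cell,
    for its negation those with the other label. The difference of the two indicators is the
    variable to be bounded. *)
Definition labelled B e : set ('rV[R]_d * bool) :=
  \bigcup_(j in [set` B]) (A j `*` [set e j]).

Lemma measurable_cell_union B : measurable (cell_union B).
Proof.
rewrite /cell_union bigcup_mkcond.
apply: countable_bigcupT_measurable => // j; case: ifP => // _.
exact: measurable_cell cpA j.
Qed.

Lemma measurable_region B : measurable (region B).
Proof.
apply: measurableI; first exact: measurable_domain.
exact: measurable_cell_union.
Qed.

Lemma region_domain B : region B `<=` domain.
Proof. by move=> x []. Qed.

Lemma measurable_labelled B e : measurable (labelled B e).
Proof.
rewrite /labelled bigcup_mkcond.
apply: countable_bigcupT_measurable => // j; case: ifP => // _.
by apply: measurable_cross; exact: measurable_cell cpA j.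
Qed.

Lemma labelled_disj B e : labelled B e `&` labelled B (negb \o e) = set0.
Proof.
apply/seteqP; split=> // -[x b] [[j /= _ [/= Ajx ->]] [k /= _ [/= Akx]]].
by rewrite (cell_inj cpA Ajx Akx); case: (e k).
Qed.

Lemma in_labelled B e z :
  (z \in labelled B e : nat) = (\sum_(j in B) (z \in A j `*` [set e j]))%N.
Proof.
case: (boolP (z \in labelled B e)) => [|zB].
  rewrite inE => -[j /= jB [Ajz ejz]].
  rewrite (bigD1 j) //= in_cross mem_set// ejz eqxx /= big1 ?addn0// => k /andP[_ kj].
  rewrite in_cross memNset ?andbF// => Akz; move/eqP : kj; apply.
  exact/val_inj/(cell_inj cpA Akz Ajz).
rewrite big1// => j jB; apply/eqP; rewrite eqb0; apply: contra zB.
by rewrite !inE => h; exists j.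
Qed.

Lemma sum_labelled n (D : n.-tuple ('rV[R]_d * bool)) B e :
  (\sum_(k < n) (tnth D k \in labelled B e) =
   \sum_(j in B) cell_count A D j (e j))%N.
Proof.
by rewrite exchange_big; apply: eq_bigr => k _; exact: in_labelled.
Qed.

Lemma P_domain S : measurable S -> P S = P (S `&` (domain `*` setT)).
Proof.
move=> mS.
have mD : measurable (@domain R d `*` [set: bool]).
  by apply: measurableX => //; exact: measurable_domain.
rewrite (measureDI P mS mD) [X in (X + _)%E](_ : _ = 0%E) ?add0e//.
apply/eqP; rewrite eq_le measure_ge0 andbT.
apply: (@le_trans _ _ (P (~` (domain `*` setT)))).
  apply: le_measure; rewrite ?inE//.
  - exact: measurableD.
  - exact: measurableC.
by rewrite probability_setC// PD subee.
Qed.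

(** Splitting [B] by [e] produces two products, to which the posterior formulas apply. *)
Lemma P_labelled B e : P (labelled B e) =
  (P (region [set j in B | e j]%SET `*` [set true]) +
   P (region [set j in B | ~~ e j]%SET `*` [set false]))%E.
Proof.
rewrite P_domain; last exact: measurable_labelled.
rewrite -measureU; last first.
- by apply/seteqP; split=> // -[x []] /= [[_ ?] [_ ?]].
- by apply: measurable_cross; exact: measurable_region.
- by apply: measurable_cross; exact: measurable_region.
congr (P _); apply/seteqP; split=> -[x b].
- move=> [[j /= jB [/= Ajx ->]] [/= dx _]].
  case: (boolP (e j)) => ej; [left|right]; split=> //; split=> //; exists j => //=;
    by rewrite inE jB.
- by move=> [|] [[/= dx [j /= + Ajx]] /= ->]; rewrite inE => /andP[jB ej];
    split=> //; exists j => //; split=> //=; rewrite ?ej // (negbTE ej).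
Qed.

Lemma region_label B :
  region B = region [set j in B | cell_label j]%SET `|`
             region [set j in B | ~~ cell_label j]%SET.
Proof.
apply/seteqP; split=> [x [dx [j /= jB Ajx]]|x].
  case: (boolP (cell_label j)) => ej; [left|right]; split=> //; exists j => //=;
    by rewrite inE jB.
by move=> [|] [dx [j /= + Ajx]]; rewrite inE => /andP[jB ej]; split=> //; exists j.
Qed.

Lemma region_label_disj B :
  region [set j in B | cell_label j]%SET `&`
  region [set j in B | ~~ cell_label j]%SET = set0.
Proof.
apply/seteqP; split=> // x [[_ [j /= + Ajx]] [_ [k /= + Akx]]].
rewrite !inE => /andP[_ lj] /andP[_ lk].
by rewrite -(cell_inj cpA Ajx Akx) lj in lk.
Qed.

Lemma region_label_eta B x : region [set j in B | cell_label j]%SET x ->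
  2^-1 <= eta x.
Proof.
move=> [dx [j /= + Ajx]]; rewrite inE => /andP[_ /asboolP h].
rewrite leNgt; apply/negP => ex; suff : set0 x by [].
by rewrite -h.
Qed.

Lemma region_unlabel_eta B x : (forall j, j \in B -> pure_cell j) ->
  region [set j in B | ~~ cell_label j]%SET x -> eta x <= 2^-1.
Proof.
move=> pB [dx [j /= + Ajx]]; rewrite inE => /andP[/pB + lj].
rewrite /pure_cell (negbTE lj) /= => /asboolP h.
rewrite leNgt; apply/negP => ex; suff : set0 x by [].
by rewrite -h.
Qed.

(** This is the mean of the signed variable: eta >= 1/2 on the cells labelled [true] and eta <= 1/2
    on the others, so on both parts the optimal label outweighs the other one by the noise mass. *)
Lemma labelled_diff B : (forall j, j \in B -> pure_cell j) ->
  fine (P (labelled B cell_label)) - fine (P (labelled B (negb \o cell_label))) =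
  fine (noise_mass P eta (region B)).
Proof.
move=> pB; rewrite !P_labelled.
rewrite (_ : [set j in B | ~~ (negb \o cell_label) j]%SET =
    [set j in B | cell_label j]%SET); last first.
  by apply/setP => j; rewrite !inE /= negbK.
rewrite (region_label B).
set U := region [set j in B | cell_label j]%SET.
set V := region [set j in B | ~~ cell_label j]%SET.
have mU : measurable U by exact: measurable_region.
have mV : measurable V by exact: measurable_region.
have UD : U `<=` domain by exact: region_domain.
have VD : V `<=` domain by exact: region_domain.
have fin b W : measurable W -> P (W `*` [set b]) \is a fin_num.
  by move=> mW; apply: fin_num_measure; exact: measurable_cross.
have nfU := noise_mass_fin post mU UD; have nfV := noise_mass_fin post mV VD.
rewrite (noise_mass_pos post mU UD); last exact: region_label_eta.
rewrite (noise_mass_neg post mV VD); last by move=> x; exact: region_unlabel_eta.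
rewrite (noise_mass_setU post mU mV UD VD (region_label_disj B)).
move: (noise_mass P eta U) (noise_mass P eta V) nfU nfV => a b afin bfin.
rewrite !fineD ?fin_numD ?fin ?afin ?bfin//.
lra.
Qed.

(** The second moment of the signed variable, whose square is 1 on both sets. *)
Lemma labelled_sum B :
  fine (P (labelled B cell_label)) + fine (P (labelled B (negb \o cell_label))) =
  fine (marginal P (region B)).
Proof.
rewrite !P_labelled.
rewrite (_ : [set j in B | ~~ (negb \o cell_label) j]%SET =
    [set j in B | cell_label j]%SET); last first.
  by apply/setP => j; rewrite !inE /= negbK.
rewrite (region_label B).
set U := region [set j in B | cell_label j]%SET.
set V := region [set j in B | ~~ cell_label j]%SET.
have mU : measurable U by exact: measurable_region.
have mV : measurable V by exact: measurable_region.
have fin b W : measurable W -> P (W `*` [set b]) \is a fin_num.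
  by move=> mW; apply: fin_num_measure; exact: measurable_cross.
have -> : marginal P (U `|` V) = (marginal P U + marginal P V)%E.
  by apply: measureU => //; exact: region_label_disj.
rewrite !marginal_cross// !fineD ?fin_numD ?fin//.
lra.
Qed.

End pure_cells.

Lemma sum_cst_le_card (R : realType) (I : finType) (F : pred I) (X : {set I})
    (c : R) : 0 <= c -> (forall i, F i -> i \in X) ->
  \sum_(i | F i) c <= c * #|X|%:R.
Proof.
move=> c0 FX; rewrite big_const iter_addr_0 -(mulr_natr c) ler_wpM2l// ler_nat.
by apply: subset_leq_card; apply/fintype.subsetP => i; exact: FX.
Qed.

(** * Concentration of the histogram rule *)

Section histogram_concentration.
Context (R : realType) (d : nat) (P : probability ('rV[R]_d * bool)%type R).
Variables (eta : 'rV[R]_d -> R) (s : R) (A : nat -> set 'rV[R]_d) (N n : nat).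
Hypothesis PD : P (domain `*` setT) = 1%E.
Hypothesis post : is_posterior P eta.
Hypothesis cpA : cubic_partition s A.
Hypothesis s0 : 0 <= s.
Hypothesis n0 : (0 < n)%N.
Implicit Types (B J : {set 'I_N}) (D : n.-tuple ('rV[R]_d * bool)).

Let region B := region A B.
Let mass B : R := fine (noise_mass P eta (region B)).
Let prob B : R := fine (marginal P (region B)).

(** A negative [cell_sign] is the prediction -1, so equality of the two booleans means that the
    prediction differs from the optimal label. *)
Definition wrong_cell D j : bool :=
  (cell_sign A D j < 0) == cell_label eta A j.

Definition wrong_pure_cells D J : {set 'I_N} :=
  [set j in J | pure_cell eta A j && wrong_cell D j]%SET.

(** On a wrong cell the vote went against the optimal label or was tied; these inequalities between
    counts add up over [B]. *)
Lemma wrong_cell_count D B : (forall j, j \in B -> wrong_cell D j) ->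
  (\sum_(k < n) (tnth D k \in labelled A B (cell_label eta A)) <=
   \sum_(k < n) (tnth D k \in labelled A B (negb \o cell_label eta A)))%N.
Proof.
move=> wB; rewrite !(sum_labelled cpA); apply: leq_sum => j /wB.
rewrite /wrong_cell /cell_sign /=.
case: (leqP (cell_count A D j false) (cell_count A D j true)) => h.
  by rewrite ltr10 => /eqP <-.
by rewrite ltrN10 => /eqP <- /=; exact: ltnW.
Qed.

(** A misclassified point lies either in a mixed cell, which holds a point of the opposite side at
    distance at most [s], or in a pure cell where the rule is wrong. *)
Lemma error_set_cover D (J1 J2 : {set 'I_N}) :
  (forall x, domain x -> exists2 j : 'I_N, j \in J1 :|: J2 & A j x) ->
  (noise_mass P eta (error_set eta (hist_rule A D)) <=
   noise_mass P eta [set x | domain x /\ (Delta eta x <= s%:E)%E] +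
   noise_mass P eta (region (wrong_pure_cells D J1)) +
   noise_mass P eta (region (wrong_pure_cells D J2)))%E.
Proof.
move=> cover; set E := error_set _ _.
set B1 := wrong_pure_cells D J1; set B2 := wrong_pure_cells D J2.
have mh : measurable_fun domain (hist_rule A D) := measurable_hist_rule cpA D n0.
have mE : measurable E by exact: (measurable_error_set post mh).
have ED : E `<=` domain by exact: error_set_domain.
pose mixed := E `&` region [set j : 'I_N | ~~ pure_cell eta A j]%SET.
have mR B : measurable (region B) by exact: measurable_region cpA B.
have RD B : region B `<=` domain by exact: region_domain.
have mM : measurable mixed by exact: measurableI.
have MD : mixed `<=` domain by move=> x [/ED].
have EM : E `<=` mixed `|` region B1 `|` region B2.
  move=> x Ex; have dx := ED _ Ex; have [j jJ Ajx] := cover x dx.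
  have [pj|pj] := boolP (pure_cell eta A j); last first.
    by left; left; split=> //; split=> //; exists j => //=; rewrite inE.
  suff wj : wrong_cell D j.
    by move: jJ; rewrite inE => /orP[] jJ; [left; right|right]; split=> //;
      exists j => //=; rewrite inE jJ pj wj.
  rewrite /wrong_cell; case: Ex => -[xs /=]; rewrite (hist_rule_cell cpA D n0 Ajx).
    move=> ->; rewrite eq_sym eqb_id; apply: contraT => lj.
    move: pj; rewrite /pure_cell (negbTE lj) /= => /asboolP h.
    by have : set0 x by rewrite -h.
  rewrite leNgt => /negbTE ->; rewrite eq_sym eqbF_neg; apply/negP => /asboolP h.
  by have : set0 x by rewrite -h.
have mixedD : mixed `<=` [set x | domain x /\ (Delta eta x <= s%:E)%E].
  move=> x [Ex [dx [j /= + Ajx]]]; rewrite inE /pure_cell negb_or => /andP[].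
  move=> /asboolP/eqP/set0P[y [Ajy ny]] /asboolP/eqP/set0P[z [Ajz pz]].
  split=> //; case: Ex => -[xs _].
    by have [] := opposite_sides_Delta_le xs ny (cell_dist cpA s0 Ajx Ajy).
  by have [] := opposite_sides_Delta_le pz xs (cell_dist cpA s0 Ajz Ajx).
apply: (le_trans (noise_mass_mono P eta EM)).
apply: (le_trans (noise_massU post _ _ _ _)) => //.
- exact: measurableU.
- by rewrite subUset.
rewrite leeD//; apply: (le_trans (noise_massU post _ _ _ _)) => //.
by rewrite leeD//; exact: noise_mass_mono.
Qed.

Lemma region_mass_fin B : (mass B)%:E = noise_mass P eta (region B).
Proof.
rewrite /mass fineK//; apply: noise_mass_fin => //.
  exact: measurable_region cpA B.
exact: region_domain.
Qed.

(** A set of pure cells is bad if its mass is too large for its cells to be all wrong, save on an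
    unlikely event. Outside these events the wrong cells of either family do not form a bad set, and
    the last two hypotheses bound their mass. *)
Lemma histogram_excess_risk (J1 J2 : {set 'I_N}) (tau M1 M2 : R) :
  (forall x, domain x -> exists2 j : 'I_N, j \in J1 :|: J2 & A j x) ->
  0 <= tau ->
  (forall B, B \subset J1 ->
     mass B ^+ 2 <= 2 * prob B * ((tau + #|J1|%:R) / n%:R) -> mass B <= M1) ->
  (forall B, B \subset J2 ->
     mass B ^+ 2 <= 2 * prob B * ((tau + #|J2|%:R) / n%:R) -> mass B <= M2) ->
  ((1 - 2 * expR (- tau))%:E <=
   power_measure P [set D : n.-tuple ('rV[R]_d * bool)%type |
     (risk P (hist_rule A D) - bayes_risk P <=
      noise_mass P eta [set x | domain x /\ (Delta eta x <= s%:E)%E] +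
      (M1 + M2)%:E)%E])%E.
Proof.
move=> cover tau0 HM1 HM2.
pose L J : R := (tau + #|J|%:R) / n%:R.
pose bad J B := [&& B \subset J, [forall j in B, pure_cell eta A j]
   & 2 * prob B * L J < mass B ^+ 2].
pose F : pred {set 'I_N} := [pred B | bad J1 B || bad J2 B].
(* A set that is bad for both families is charged to [J1]. *)
pose LL B := if bad J1 B then L J1 else L J2.
have nR : 0 < n%:R :> R by rewrite ltr0n.
have L0 J : 0 <= L J by rewrite divr_ge0// addr_ge0.
(* The summand #|J| in [L] pays for the 2^#|J| subsets, since 2 <= e. *)
have sum_bad J : \sum_(B | bad J B) expR (- (n%:R * L J)) <= expR (- tau).
  apply: le_trans (_ : expR (- (n%:R * L J)) * #|powerset J|%:R <= _).
    apply: sum_cst_le_card; first exact: expR_ge0.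
    by move=> B /and3P[BJ _ _]; rewrite powersetE.
  have -> : n%:R * L J = tau + #|J|%:R by rewrite /L mulrC divfK ?gt_eqF.
  rewrite card_powerset opprD expRD -mulrA.
  rewrite ler_piMr ?expR_ge0// expRN mulrC ler_pdivrMr ?expR_gt0// mul1r.
  rewrite -[X in expR X]mulr1 expRM_natl natrX lerXn2r ?nnegrE ?expR_ge0//.
  by apply: le_trans (expR_ge1Dx 1); lra.
apply: (@le_trans _ _ (1 - \sum_(B | F B) expR (- (n%:R * LL B)))%:E).
  rewrite lee_fin lerD2l lerN2 (bigID (bad J1)) /=.
  rewrite (_ : 2 * expR (- tau) = expR (- tau) + expR (- tau)); last by lra.
  apply: lerD.
    rewrite (eq_bigl (bad J1)); last by move=> B; rewrite /F inE; case: (bad J1 B) => //; rewrite andbF.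
    by apply: le_trans (sum_bad J1); apply: ler_sum => B bB; rewrite /LL bB.
  apply: le_trans (sum_bad J2).
  rewrite [leRHS](bigID (bad J1)) /= -[leLHS]add0r; apply: lerD.
    by apply: sumr_ge0 => B _; exact: expR_ge0.
  rewrite (eq_bigl (fun B => bad J2 B && ~~ bad J1 B)); last first.
    by move=> B; rewrite /F inE; case: (bad J1 B) => //; rewrite !andbF.
  by apply: ler_sum => B /andP[_ /negbTE bB]; rewrite /LL bB.
have pureP B : [forall j in B, pure_cell eta A j] -> forall j, j \in B -> pure_cell eta A j.
  by move=> /forall_inP.
apply: (power_measure_chernoff
  (S := fun B => labelled A B (cell_label eta A))
  (S' := fun B => labelled A B (negb \o cell_label eta A)) (F := F) (L := LL)).
- by move=> B; exact: measurable_labelled cpA B _.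
- by move=> B; exact: measurable_labelled cpA B _.
- by move=> B; exact: labelled_disj cpA B _.
- move=> B FB /=.
  have pB : [forall j in B, pure_cell eta A j].
    by move: FB => /= /orP[] /and3P[].
  rewrite (labelled_diff PD post cpA (pureP _ pB)) (labelled_sum eta PD cpA).
  split; first by rewrite /LL; case: ifP.
    by rewrite fine_ge0// noise_mass_ge0.
  rewrite /LL; case: ifP => [/and3P[_ _ //]|bB].
  by move: FB; rewrite /F inE bB => /and3P[].
move=> D; apply: contra_notP => nF /=.
(* Were the set of all wrong pure cells of [J] bad, its counts would put [D] in one of the excluded
   events. *)
have good J (M : R) : {subset bad J <= F} ->
    (forall B, B \subset J -> mass B ^+ 2 <= 2 * prob B * L J -> mass B <= M) ->
    (noise_mass P eta (region (wrong_pure_cells D J)) <= M%:E)%E.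
  move=> bF; set B := wrong_pure_cells D J; move=> HM.
  rewrite -region_mass_fin lee_fin.
  have BJ : B \subset J by apply/fintype.subsetP => j; rewrite inE => /andP[].
  apply: HM => //; rewrite leNgt; apply/negP => h; apply: nF; exists B.
    apply: bF; rewrite unfold_in /bad BJ h andbT /=.
    by apply/forall_inP => j; rewrite inE => /and3P[].
  by apply: wrong_cell_count => j; rewrite inE => /and3P[].
apply: (le_trans (excess_risk_le post (measurable_hist_rule cpA D n0))).
apply: (le_trans (error_set_cover D cover)).
have sub1 : {subset bad J1 <= F} by move=> B bB; apply/orP; left.
have sub2 : {subset bad J2 <= F}. by move=> B bB; apply/orP; right.
rewrite EFinD [leRHS]addeA.
exact: (leeD (leeD (lexx _) (good J1 M1 sub1 HM1)) (good J2 M2 sub2 HM2)).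
Qed.

End histogram_concentration.

(** * Probability bounded by noise mass *)

Section noise_control.
Context (R : realType) (d : nat) (P : probability ('rV[R]_d * bool)%type R).
Variables (eta : 'rV[R]_d -> R) (gamma cLC : R).
Hypothesis post : is_posterior P eta.
Hypothesis gamma0 : 0 <= gamma.
Hypothesis cn : controls_noise P eta gamma cLC.
Implicit Types (B : set 'rV[R]_d) (u : R).

(** Where Delta >= u, the noise control gives 1 <= cLC u^-gamma |2 eta - 1| outside a null set [Z];
    this is integrated over [B] without [Z]. *)
Lemma marginal_far_le B u : measurable B -> B `<=` domain -> 0 < u ->
  (forall x, B x -> (u%:E <= Delta eta x)%E) ->
  (marginal P B <= (cLC * u `^ (- gamma))%:E * noise_mass P eta B)%E.
Proof.
move=> mB BD u0 BDelta; have [cLC0 [Z [mZ Z0 subZ]]] := cn.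
have mBZ : measurable (B `\` Z) by exact: measurableD.
have -> : marginal P B = marginal P (B `\` Z).
  rewrite (measureDI (marginal P) mB mZ) [X in (_ + X)%E](_ : _ = 0%E) ?adde0//.
  apply: (subset_measure0 (B := Z)) => //; exact: measurableI.
apply: (@le_trans _ _ ((cLC * u `^ (- gamma))%:E * noise_mass P eta (B `\` Z))%E); last first.
  apply: lee_wpmul2l; first by rewrite lee_fin mulr_ge0 ?powR_ge0// ltW.
  by apply: noise_mass_mono; exact: subDsetl.
have mn : measurable_fun (B `\` Z) (fun x => `|2 * eta x - 1|%:E).
  by apply: (measurable_noise post) => // x [/BD].
rewrite /noise_mass -ge0_integralZl_EFin//; last first.
  by rewrite mulr_ge0 ?powR_ge0// ltW.
rewrite -[leLHS]mul1e -integral_cst//; apply: ge0_le_integral => //.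
  exact: measurable_funeM.
move=> x [Bx nZx]; rewrite -EFinM lee_fin.
have : (poweR (Delta eta x) gamma <= (cLC * `|2 * eta x - 1|)%:E)%E.
  by apply: contrapT => h; apply: nZx; apply: subZ => /= H; apply: h; apply: H; exact: BD.
have : (poweR u%:E gamma <= poweR (Delta eta x) gamma)%E.
  by apply: gt0_ler_poweR => //; rewrite ?in_itv/= ?leey ?andbT ?lee_fin ?(ltW u0)//;
    [apply: le_trans (BDelta _ Bx); rewrite lee_fin ltW|exact: BDelta].
move=> h1 h2; have := le_trans h1 h2; rewrite poweR_EFin lee_fin => h.
rewrite powRN mulrAC -/(_ / _) ler_pdivlMr ?powR_gt0// mul1r.
exact: h.
Qed.

(** [B] is split at Delta = u, with [marginal_far_le] for the far part; the near part is left to the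
    margin exponent. *)
Lemma marginal_le B u : measurable B -> B `<=` domain -> 0 < u ->
  (marginal P B <= marginal P [set x | domain x /\ (Delta eta x < u%:E)%E] +
    (cLC * u `^ (- gamma))%:E * noise_mass P eta B)%E.
Proof.
move=> mB BD u0; set S := [set x | _].
have mS : measurable S by apply: measurable_Delta_lt => //; case: post.
rewrite (measureDI (marginal P) mB mS) addeC; apply: leeD.
  apply: le_measure; rewrite ?inE//; first exact: measurableI.
have mBS : measurable (B `\` S) by exact: measurableD.
apply: (le_trans (marginal_far_le mBS _ u0 _)).
- by move=> x [/BD].
- by move=> x [Bx nS]; rewrite leNgt; apply/negP => h; apply: nS; split=> //; exact: BD.
apply: lee_wpmul2l; last by apply: noise_mass_mono; exact: subDsetl.
by case: cn => cLC0 _; rewrite lee_fin mulr_ge0 ?powR_ge0// ltW.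
Qed.

End noise_control.

(** * Counting cells *)

(* Three points such that any interval of length s meeting [0, h], h <= s,
   contains one of them, whichever of its endpoints belong to it. *)
Definition offset (R : realType) (s : R) (o : 'I_3) : R :=
  if o == 0%N :> nat then - (s / 2)
  else if o == 1%N :> nat then s / 4 else s + s / 8.

Lemma offset_exists (R : realType) (s h u x a : R) (b c : bool) :
  0 < s -> h <= s -> u <= x <= u + h ->
  x \in Interval (BSide b a) (BSide c (a + s)) ->
  exists m : 'I_3, u + offset s m \in Interval (BSide b a) (BSide c (a + s)).
Proof.
move=> s0 hs /andP[ux xu] xI.
have /andP[ax xa] : a <= x <= a + s.
  by move: xI; rewrite itv_boundlr /= => /andP[]; case: b; case: c; rewrite !bnd_simp;
    move=> ? ?; apply/andP; split=> //; exact: ltW.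
suff: exists m : 'I_3, a < u + offset s m < a + s.
  move=> [m /andP[m1 m2]]; exists m; rewrite itv_boundlr /=; apply/andP.
  by case: b {xI}; case: c; rewrite !bnd_simp; split=> //; exact: ltW.
(* Here u - s <= a <= u + s. Cutting this range at u - s / 2 and u + s / 4 leaves, on each piece,
   one offset point strictly between a and a + s. *)
have [a1|a1] := ltP a (u - s / 2).
  by exists (@Ordinal 3 0 isT); rewrite /offset /=; apply/andP; split; lra.
have [a2|a2] := ltP a (u + s / 4).
  by exists (@Ordinal 3 1 isT); rewrite /offset /=; apply/andP; split; lra.
by exists (@Ordinal 3 2 isT); rewrite /offset /=; apply/andP; split; lra.
Qed.

Lemma dist_le_side (R : realType) (s h u x t : R) : h <= s ->
  u <= x <= u + h -> u < t < u + h -> `|x - t| <= s.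
Proof.
by move=> hs /andP[x1 x2] /andP[t1 t2]; rewrite ler_norml; apply/andP; split; lra.
Qed.

Section counting.
Context (R : realType) (d : nat) (s : R) (A : nat -> set 'rV[R]_d) (K : nat).
Hypothesis cpA : cubic_partition s A.
Hypothesis s0 : 0 < s.
Hypothesis K0 : (0 < K)%N.
(** The side of an auxiliary grid of K^d boxes on the domain. The cells of the partition need not be
    aligned, so they are counted through this grid. *)
Let h : R := 2 / K%:R.
Hypothesis hs : h <= s.
Let box_index : finType := {ffun 'I_d -> 'I_K}.
(** A code is a box with one of its 3^d offset points. Each cell that meets the domain contains the
    point of some code, so there are at most (3 K)^d such cells. *)
Let code : finType := (box_index * {ffun 'I_d -> 'I_3})%type.
Implicit Types (x y : 'rV[R]_d) (k : box_index) (q : code).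

Let h0 : 0 < h. Proof. by rewrite divr_gt0// ltr0n. Qed.

Definition corner (k : nat) : R := -1 + k%:R * h.

Definition closed_box k : set 'rV[R]_d :=
  [set x | forall i, corner (k i) <= x ord0 i <= corner (k i) + h].

Definition code_point q : 'rV[R]_d :=
  \row_i (corner (q.1 i) + offset s (q.2 i)).

Lemma corner_exists (x : R) : -1 <= x <= 1 ->
  exists k : 'I_K, corner k <= x <= corner k + h.
Proof.
move=> /andP[x1 x2].
(* Search downwards from corner K = 1 for the first corner not above [x]. *)
suff H m : (m <= K)%N -> x <= corner m -> (0 < m)%N ->
    exists k : 'I_K, corner k <= x <= corner k + h.
  apply: (H K) => //; rewrite /corner /h mulrC divfK ?pnatr_eq0 ?gtn_eqF//; lra.
elim: m => // m IH mK xm _.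
have [xm'|xm'] := leP (corner m) x.
  exists (Ordinal mK); rewrite xm' /=; move: xm; rewrite /corner -natr1; lra.
case: m IH mK xm xm' => [|m] IH mK xm xm'.
  by move: xm'; rewrite /corner mul0r; lra.
by apply: IH => //; [exact: ltnW|exact: ltW].
Qed.

Lemma code_exists j x : domain x -> A j x ->
  exists q, closed_box q.1 x /\ A j (code_point q).
Proof.
move=> dx; case: cpA => /(_ j)[a [b [c ->]]] _ _ /= Ax.
have [k kP] := choice (fun i => corner_exists (dx i)).
have [m mP] := choice (fun i => offset_exists s0 hs (kP i) (Ax i)).
exists ([ffun i => k i], [ffun i => m i]); split=> i /=; rewrite ?mxE ?ffunE//.
Qed.

(* The numbers of the cells that meet the domain are bounded. *)
Lemma finite_cover : exists N : nat, exists idx : code -> 'I_N,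
  forall j q, A j (code_point q) -> idx q = j :> nat.
Proof.
have H q : exists j, A j (code_point q).
  have [j _ Aj] : (\bigcup_j A j) (code_point q) by case: cpA => _ _ ->.
  by exists j.
have [idx idxP] := choice H.
exists (\max_q idx q).+1, (fun q => inord (idx q)) => j q Ajq.
have lt_idx : (idx q < (\max_q idx q).+1)%N by rewrite ltnS; exact: leq_bigmax.
by rewrite inordK//; exact (cell_inj cpA (idxP q) Ajq).
Qed.

Variable eta : 'rV[R]_d -> R.

Definition near_box r : {set box_index} :=
  [set k : box_index | `[< exists x, [/\ domain x, closed_box k x &
     (Delta eta x <= r%:E)%E] >]]%SET.

(** Closed boxes cover the domain, but only open ones are disjoint, as a comparison of volumes
    requires. *)
Definition open_side k (i : 'I_d) : interval R :=
  `]corner (k i), corner (k i) + h[.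

Lemma corner_uniq (m m' : nat) (t : R) :
  corner m < t < corner m + h -> corner m' < t < corner m' + h -> m = m'.
Proof.
have lt_corner (l l' : nat) : corner l < t -> t < corner l' + h -> (l <= l')%N.
  move=> lt1 lt2; rewrite -ltnS -(ltr_nat R) -natr1 -(ltr_pM2r h0) mulrDl mul1r.
  by rewrite -(ltrD2l (-1)) addrA; exact: lt_trans lt1 lt2.
move=> /andP[a1 a2] /andP[b1 b2]; apply/eqP.
by rewrite eqn_leq !lt_corner.
Qed.

(** By [Delta_lipschitz], an open box whose closure has a point with Delta <= r lies in {Delta <= r
    + s}, its side being at most [s]. The volumes of these disjoint boxes add up through
    [power_measure_ge], applied to products of interval indicators. *)
Lemma near_box_volume r : 0 <= r ->
  Xzero eta = rel_boundary (Xpos eta) -> Xzero eta = rel_boundary (Xneg eta) ->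
  ((#|near_box r|%:R * h ^+ d)%:E <=
   lebesgue_rV [set x : 'rV[R]_d | domain x /\ (Delta eta x <= (r + s)%:E)%E])%E.
Proof.
move=> r0 bpos bneg.
pose c k : R := (k \in near_box r)%:R.
pose phi k (i : 'I_d) : R -> R := \1_[set` open_side k i].
have int_phi k i : (\int[lebesgue_measure]_t (phi k i t)%:E = h%:E)%E.
  transitivity (lebesgue_measure ([set` open_side k i] : set R)).
    by rewrite integral_indic// setIT.
  rewrite lebesgue_measure_itv /= lte_fin ltrDl h0.
  by rewrite -EFinB addrC addKr.
have -> : #|near_box r|%:R * h ^+ d =
    \sum_k c k * \prod_i fine (\int[lebesgue_measure]_t (phi k i t)%:E).
  under [RHS]eq_bigr do under eq_bigr do rewrite int_phi.
  under [RHS]eq_bigr do rewrite prodr_const card_ord.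
  by rewrite -mulr_suml -sum1_card big_mkcond natr_sum.
apply: power_measure_ge => [k i|t]; first exact: integrable_indic_itv.
set G := [set _ | _].
have prod01 k : \prod_i phi k i (tnth t i) =
    [forall i, tnth t i \in open_side k i]%:R.
  case: (boolP [forall i, _]) => [/forallP H|/forallPn[i Hi]].
    by rewrite big1// => i _; rewrite /phi indicE mem_set//; exact: H.
  by rewrite (bigD1 i)//= /phi indicE memNset ?mul0r//; exact/negP.
have in_G k : k \in near_box r -> [forall i, tnth t i \in open_side k i] -> G t.
  rewrite inE => /asboolP[x [dx kx xr]] /forallP tk.
  have dt : domain (\row_i tnth t i).
    move=> i; rewrite mxE; have := tk i; rewrite in_itv /= => /andP[t1 t2].
    have c0 : -1 <= corner (k i) by rewrite /corner lerDl mulr_ge0// ltW.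
    have c1 : corner (k i) + h <= 1.
      have : (k i).+1%:R * h <= K%:R * h by rewrite ler_pM2r// ler_nat.
      by rewrite -natr1 /corner mulrDl mul1r [K%:R * _]mulrC divfK ?pnatr_eq0 ?gtn_eqF//; lra.
    by lra.
  split=> //; apply: Delta_lipschitz bpos bneg dx dt r0 _ xr.
  apply/(mx_norm_leP _ (ltW s0)) => i; rewrite !mxE.
  by have := tk i; rewrite in_itv /=; exact: (dist_le_side hs (kx i)).
have [/existsP[k /andP[kn kt]]|/existsPn none] := boolP
    [exists k, (k \in near_box r) && [forall i, tnth t i \in open_side k i]].
  rewrite indicE mem_set; last exact: in_G kn kt.
  rewrite (bigD1 k)//= [X in _ + X]big1 ?addr0; last first.
    move=> k' k'k.
    rewrite prod01 (_ : [forall i, _] = false) ?mulr0//.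
    apply/negP => /forallP kt'; move/eqP : k'k; apply; apply/ffunP => i.
    apply/val_inj/(@corner_uniq _ _ (tnth t i)).
      by have := kt' i; rewrite in_itv.
    by have /forallP/(_ i) := kt; rewrite in_itv.
  by rewrite /c prod01 kt kn mulr1.
rewrite big1 => [|k _]; first by rewrite indicE.
rewrite /c prod01; have := none k; rewrite negb_and => /orP[|] /negbTE ->.
  by rewrite mul0r.
by rewrite mulr0.
Qed.

(** [Jn] holds the cells with a point of the domain where Delta <= r, [Jf] the other cells that meet
    the domain. Each is reached from a code, and a cell of [Jn] from a code whose box is near. *)
Lemma cell_cover_card r : exists N : nat, exists Jn Jf : {set 'I_N},
  [/\ forall x, domain x -> exists2 j : 'I_N, j \in Jn :|: Jf & A j x,
      (#|Jn| <= (3 * K) ^ d)%N, (#|Jf| <= (3 * K) ^ d)%N,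
      (#|Jn| <= #|near_box r| * 3 ^ d)%N &
      forall j : 'I_N, j \in Jf -> forall x, domain x -> A j x ->
        (r%:E < Delta eta x)%E].
Proof.
have [N [idx idxP]] := finite_cover.
pose J : {set 'I_N} := [set j : 'I_N | `[< exists2 x, domain x & A j x >]]%SET.
pose Jn : {set 'I_N} := [set j : 'I_N | `[< exists x, [/\ domain x, A j x &
  (Delta eta x <= r%:E)%E] >]]%SET.
have cardJ : (#|J| <= (3 * K) ^ d)%N.
  apply: (@leq_trans #|idx @: [set: code]%SET|).
    apply: subset_leq_card; apply/fintype.subsetP => j; rewrite inE => /asboolP[x dx Ajx].
    have [q [_ /idxP qj]] := code_exists dx Ajx.
    by apply/imsetP; exists q; rewrite ?inE//; exact/val_inj.
  apply: (leq_trans (leq_imset_card _ _)).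
  by rewrite cardsT card_prod !card_ffun !card_ord mulnC expnMn.
have cardJn : (#|Jn| <= #|near_box r| * 3 ^ d)%N.
  apply: (@leq_trans #|idx @: finset.setX (near_box r) finset.setT|).
    apply: subset_leq_card; apply/fintype.subsetP => j; rewrite inE.
    move=> /asboolP[x [dx Ajx xr]].
    have [q [qx /idxP qj]] := code_exists dx Ajx.
    apply/imsetP; exists q; last exact/val_inj.
    by rewrite !inE andbT; apply/asboolP; exists x.
  apply: (leq_trans (leq_imset_card _ _)).
  by rewrite cardsX cardsT card_ffun !card_ord.
exists N, Jn, (J :\: Jn); split=> //.
- move=> x dx; have [j _ Ajx] : (\bigcup_j A j) x by case: cpA => _ _ ->.
  have [q [_ Ajq]] := code_exists dx Ajx; have qj := idxP _ _ Ajq.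
  exists (idx q); last by rewrite qj.
  rewrite finset.in_setU finset.in_setD; case: (boolP (idx q \in Jn)) => //= _.
  by rewrite inE; apply/asboolP; exists x => //; rewrite qj.
- apply: leq_trans cardJ; apply: subset_leq_card; apply/fintype.subsetP => j.
  rewrite inE => /asboolP[x [dx Ajx _]].
  by rewrite inE; apply/asboolP; exists x.
- by apply: leq_trans cardJ; exact/subset_leq_card/subsetDl.
- move=> j; rewrite !inE => /andP[/asboolP nJn _] x dx Ajx; rewrite ltNge.
  by apply/negP => xr; apply: nJn; exists x.
Qed.

End counting.

(** [K] is the least integer above 2 / s, and s <= 1 gives K <= 2 / s + 1 <= 4 / s. *)
Lemma grid_size (R : realType) (s : R) : 0 < s <= 1 ->
  exists K : nat, [/\ (0 < K)%N, 2 / K%:R <= s, s / 2 <= 2 / K%:R & K%:R <= 4 / s].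
Proof.
move=> /andP[s0 s1]; exists (Num.truncn (2 / s)).+1.
have s2 : 0 <= 2 / s by rewrite divr_ge0// ltW.
have /andP[t1 t2] := truncn_itv s2.
have K0 : 0 < (Num.truncn (2 / s)).+1%:R :> R by rewrite ltr0n.
have K4 : (Num.truncn (2 / s)).+1%:R <= 4 / s.
  rewrite -natr1; apply: (@le_trans _ _ (2 / s + 2 / s)).
    by rewrite lerD// ler_pdivlMr// mul1r; lra.
  by rewrite -mulrDl; lra.
split=> //.
- by rewrite ler_pdivrMr// mulrC -ler_pdivrMr// ltW.
- rewrite ler_pdivlMr// mulrAC -ler_pdivlMr ?invr_gt0// invrK.
  by move: K4; rewrite ler_pdivlMr// mulrC; lra.
Qed.

(** * Rates *)

Section rates.
Context (R : realType).
Implicit Types (a g m p L V u s q t S e k ct : R).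

Lemma powR_cancel x e : 0 <= x -> e != 0 -> (x `^ e) `^ e^-1 = x.
Proof. by move=> x0 e0; rewrite -powRrM divff// powRr1. Qed.

Lemma powRV x e : 0 <= x -> x^-1 `^ e = (x `^ e)^-1.
Proof. by move=> x0; rewrite -[x^-1]powR_inv1// -powRrM mulN1r powRN. Qed.

Lemma linear_selfbound m p L V : 0 <= L -> 0 <= V -> 0 <= m ->
  m ^+ 2 <= 2 * p * L -> p <= V * m -> m <= 2 * V * L.
Proof.
move=> L0 V0; rewrite le_eqVlt => /predU1P[<- _ _|m0 mpL pV].
  by rewrite !mulr_ge0.
rewrite -(ler_pM2r m0) -expr2; apply: (le_trans mpL).
have : p * L <= V * m * L by rewrite ler_wpM2r.
by rewrite -!mulrA [L * m]mulrC; lra.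
Qed.

(** The choice u = m^(1 / (a + g)) makes both u^a and u^-g m equal to m^(a / (a + g)). Dividing m^2
    by this power leaves m^((a + 2 g) / (a + g)). *)
Lemma margin_selfbound a g m p L cM cL : 0 < a -> 0 < g -> 0 <= L ->
  0 < cM -> 0 < cL -> 0 <= m -> m ^+ 2 <= 2 * p * L ->
  (forall u, 0 < u -> p <= (cM * u) `^ a + cL * u `^ (- g) * m) ->
  m <= (2 * (cM `^ a + cL) * L) `^ ((a + g) / (a + 2 * g)).
Proof.
move=> a0 g0 L0 cM0 cL0; rewrite le_eqVlt => /predU1P[<- _ _|m0 mpL pu].
  exact: powR_ge0.
have ag0 : 0 < a + g by lra.
have ag2 : 0 < a + 2 * g by lra.
have u0 : 0 < m `^ (a + g)^-1 by exact: powR_gt0.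
have pm : p <= (cM `^ a + cL) * m `^ (a / (a + g)).
  apply: (le_trans (pu _ u0)); rewrite mulrDl; apply: lerD.
    by rewrite powRM ?(ltW cM0) ?powR_ge0// -powRrM [(a + g)^-1 * a]mulrC.
  rewrite -mulrA -powRrM ler_pM2l// -[X in _ * X](powRr1 (ltW m0)) -powRD.
    by rewrite (_ : _ * - g + 1 = a / (a + g))//; field; rewrite gt_eqF.
  by rewrite (gt_eqF m0) implybT.
have key : m `^ ((a + g) / (a + 2 * g))^-1 <= 2 * (cM `^ a + cL) * L.
  rewrite -(ler_pM2r (powR_gt0 (a / (a + g)) m0)) -powRD; last first.
    by rewrite (gt_eqF m0) implybT.
  rewrite (_ : _^-1 + _ = 2%:R); last by field; rewrite !gt_eqF.
  rewrite powR_mulrn ?(ltW m0)//; apply: (le_trans mpL).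
  have : p * L <= (cM `^ a + cL) * m `^ (a / (a + g)) * L by rewrite ler_wpM2r.
  lra.
rewrite -[leLHS](@powR_cancel _ ((a + g) / (a + 2 * g))^-1) ?(ltW m0)//; last first.
  by rewrite invr_eq0 gt_eqF// divr_gt0.
rewrite invrK; apply: ge0_ler_powR => //; rewrite ?nnegrE ?powR_ge0//.
  by rewrite divr_ge0// ltW.
by rewrite !mulr_ge0// addr_ge0 ?powR_ge0// ltW.
Qed.

(** Raise the hypothesis to the power 1 + d g / k and divide by s^(d g / k). *)
Lemma side_le_radius (d : nat) s q ct g k : 0 < s -> 0 < q -> 0 < ct ->
  0 < g -> 0 < k ->
  s <= ct `^ (k / (k + d%:R * g)) * q `^ (g / (k + d%:R * g)) ->
  s <= ct * (q / s ^+ d) `^ (g / k).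
Proof.
move=> s0 q0 ct0 g0 k0 le_s.
have dg : 0 <= d%:R * g by rewrite mulr_ge0// ltW.
have kd : 0 < k + d%:R * g by rewrite ltr_wpDr.
have e0 : 0 <= (k + d%:R * g) / k by rewrite divr_ge0// ltW.
have := ge0_ler_powR e0 _ _ le_s; rewrite !nnegrE (ltW s0) => /(_ isT).
rewrite mulr_ge0 ?powR_ge0// => /(_ isT).
rewrite powRM ?powR_ge0// -!powRrM.
rewrite (_ : k / (k + d%:R * g) * ((k + d%:R * g) / k) = 1); last first.
  by field; rewrite !gt_eqF.
rewrite (_ : g / (k + d%:R * g) * ((k + d%:R * g) / k) = g / k); last first.
  by field; rewrite !gt_eqF.
rewrite (_ : (k + d%:R * g) / k = 1 + d%:R * (g / k)); last first.
  by field; rewrite !gt_eqF.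
rewrite powRD ?(gt_eqF s0) ?implybT// !powRr1 ?(ltW s0) ?(ltW ct0)//.
rewrite powRM ?(ltW q0) ?invr_ge0 ?exprn_ge0 ?(ltW s0)//.
rewrite powRV ?exprn_ge0 ?(ltW s0)// -powR_mulrn ?(ltW s0)// -[in X in _ -> X]powRrM.
by move=> ?; rewrite [leRHS]mulrA ler_pdivlMr// powR_gt0.
Qed.

Lemma radius_le ct dl t S g k : 0 < ct -> 0 < dl -> 0 < t -> 0 < S ->
  0 < g -> 0 < k -> t * (ct / dl) `^ (k / g) <= S ->
  ct * (t / S) `^ (g / k) <= dl.
Proof.
move=> ct0 dl0 t0 S0 g0 k0; rewrite mulrC -ler_pdivlMr// => le_S.
have gk : 0 <= g / k by rewrite divr_ge0// ltW.
have := ge0_ler_powR gk _ _ le_S; rewrite !nnegrE powR_ge0 => /(_ isT).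
rewrite divr_ge0 ?(ltW t0) ?(ltW S0)// => /(_ isT).
rewrite -powRrM (_ : k / g * (g / k) = 1); last by field; rewrite !gt_eqF.
rewrite powRr1; last by rewrite divr_ge0// ltW.
rewrite -[S / t]invf_div powRV; last by rewrite divr_ge0// ltW.
have r0 : 0 < (t / S) `^ (g / k) by rewrite powR_gt0// divr_gt0.
by rewrite -[leRHS]mul1r ler_pdivlMr// mulrAC ler_pdivrMr// mul1r.
Qed.

(** The exponents agree because kexp + g = (1 + g) (a + 2 g). *)
Lemma near_rate a g c ct e : 0 < a -> 0 < g -> 0 <= c -> 0 < ct -> 0 < e ->
  (c * (ct * e `^ (g / kexp g a) * e)) `^ ((a + g) / (a + 2 * g)) =
  (c * ct) `^ ((a + g) / (a + 2 * g)) *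
  e `^ ((1 + g) * (a + g) / kexp g a).
Proof.
move=> a0 g0 c0 ct0 e0.
have k0 : 0 < kexp g a.
  by rewrite /kexp addr_gt0 ?mulr_gt0 ?exprn_gt0//; lra.
have ee : e `^ (g / kexp g a) * e = e `^ (g / kexp g a + 1).
  by rewrite powRD ?(gt_eqF e0) ?implybT// powRr1// ltW.
have -> : c * (ct * e `^ (g / kexp g a) * e) = c * ct * (e `^ (g / kexp g a) * e).
  by rewrite !mulrA.
rewrite ee powRM ?mulr_ge0 ?powR_ge0 ?(ltW ct0)//.
rewrite -powRrM; congr (_ * _ `^ _); rewrite /kexp; field.
by rewrite -/(kexp g a) !gt_eqF//; lra.
Qed.

(** Since kexp - g^2 = (1 + g) (a + g), the far cells get the same power of [e] as the near ones. *)
Lemma far_rate a g ct e : 0 < a -> 0 < g -> 0 < ct -> 0 < e ->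
  (ct * e `^ (g / kexp g a)) `^ (- g) * e =
  ct `^ (- g) * e `^ ((1 + g) * (a + g) / kexp g a).
Proof.
move=> a0 g0 ct0 e0.
have k0 : 0 < kexp g a.
  by rewrite /kexp addr_gt0 ?mulr_gt0 ?exprn_gt0//; lra.
rewrite powRM ?powR_ge0 ?(ltW ct0)// -mulrA; congr (_ * _).
rewrite -[X in _ * X](powRr1 (ltW e0)) -powRrM -powRD ?(gt_eqF e0) ?implybT//.
congr (_ `^ _); rewrite /kexp; field.
by rewrite -/(kexp g a) gt_eqF.
Qed.

End rates.

(** * Noise mass of the mixed cells *)

Section margin_noise.
Context (R : realType) (d : nat) (P : probability ('rV[R]_d * bool)%type R).
Variables (eta : 'rV[R]_d -> R) (beta : \bar R) (c : R).
Hypothesis post : is_posterior P eta.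
Hypothesis MNE : has_MNE P eta beta c.

(* The factor 6 absorbs the passage from [Delta <= s] to [Delta < t], t > s. *)
Lemma noise_mass_near_boundary (s : R) : 0 < s -> (0 < beta)%E ->
  (noise_mass P eta [set x | domain x /\ (Delta eta x <= s%:E)%E] <=
   6%:E * xpow (c * s) beta)%E.
Proof.
move=> s0; have [c0 mne] := MNE.
have lt_sub (t : R) : s < t ->
    (noise_mass P eta [set x | domain x /\ (Delta eta x <= s%:E)%E] <=
     xpow (c * t) beta)%E.
  move=> st; apply: le_trans (mne t (lt_trans s0 st)).
  apply: noise_mass_mono => x [dx xs]; split=> //; apply: (le_lt_trans xs).
  by rewrite lte_fin.
case: beta lt_sub => [b| |] lt_sub //; rewrite ?lte_fin /= => b0.
  have b1 : 0 < b^-1 by rewrite invr_gt0.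
  have gt1 : 1 < 6 `^ b^-1 :> R.
    apply: (@le_lt_trans _ _ (1 `^ b^-1)); first by rewrite powR1.
    by apply: gt0_ltr_powR => //; rewrite ?nnegrE//; lra.
  (* With t = s 6^(1/b), the bound (c t)^b is exactly 6 (c s)^b. *)
  apply: (le_trans (lt_sub (s * 6 `^ b^-1) _)).
    by rewrite -[ltLHS]mulr1 ltr_pM2l.
  rewrite -EFinM lee_fin mulrA powRM ?powR_ge0 ?mulr_ge0 ?(ltW c0) ?(ltW s0)//.
  have six : (6 `^ b^-1) `^ b = 6 :> R.
    by rewrite -powRrM mulVf ?gt_eqF// powRr1.
  by rewrite six mulrC.
have [cs1|cs1] := ltP (c * s) 1.
  rewrite mule0.
  have sc : s < c^-1 by rewrite -div1r ltr_pdivlMr// mulrC.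
  (* The midpoint t of s and 1 / c still has c t < 1, where [xpow] with exponent +oo is 0. *)
  have := lt_sub ((s + c^-1) / 2) _.
  rewrite /xpow (_ : c * ((s + c^-1) / 2) < 1); last first.
    by rewrite mulrA mulrDr divff ?gt_eqF//; lra.
  by apply; lra.
case: ifP => [_|_]; last by rewrite gt0_muley ?leey// lte_fin.
rewrite mule1.
have mD := @measurable_domain R d.
have h : (noise_mass P eta domain <= marginal P domain)%E.
  exact: (noise_mass_le_marginal post mD).
apply: (@le_trans _ _ (noise_mass P eta domain)).
  by apply: noise_mass_mono => x [].
apply: (le_trans h); apply: (@le_trans _ _ 1%E).
  exact: probability_le1.
by rewrite lee_fin; lra.
Qed.

End margin_noise.

(** * From numbers of cells to deviation terms *)

Section sample_size.
Context (R : realType) (d n : nat) (s tau : R).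
Hypothesis s01 : 0 < s <= 1.
Hypothesis n0 : (0 < n)%N.
Hypothesis tau1 : 1 <= tau.

Let s0 : 0 < s. Proof. by case/andP: s01. Qed.
Let s1 : s <= 1. Proof. by case/andP: s01. Qed.
Let sd0 : 0 < s ^+ d. Proof. by rewrite exprn_gt0. Qed.
Let tau0 : 0 < tau. Proof. exact: lt_le_trans tau1. Qed.
Let n0R : 0 < n%:R :> R. Proof. by rewrite ltr0n. Qed.

Lemma sample_size_ge_card (c : nat) (C : R) :
  (tau + c%:R) * s ^+ d <= C * tau ->
  (tau + c%:R) / n%:R <= C * (tau / (s ^+ d * n%:R)).
Proof.
move=> h; rewrite invfM [tau * _]mulrA [C * _]mulrA ler_pM2r ?invr_gt0//.
by rewrite [C * _]mulrA ler_pdivlMr.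
Qed.

(** Here c s^d <= (3 K s)^d <= 12^d, and tau >= 1 lets tau be factored out. *)
Lemma sample_size_cells (K c : nat) : K%:R <= 4 / s -> (c <= (3 * K) ^ d)%N ->
  (tau + c%:R) / n%:R <= (1 + 12 ^+ d) * (tau / (s ^+ d * n%:R)).
Proof.
move=> K4 cK; apply: sample_size_ge_card; rewrite !mulrDl; apply: lerD.
  by rewrite mul1r ler_piMr ?(ltW tau0)// exprn_ile1 ?(ltW s0).
apply: (@le_trans _ _ (12 ^+ d)); last by rewrite ler_peMr// exprn_ge0.
apply: (@le_trans _ _ (((3 * K) ^ d)%:R * s ^+ d)).
  by rewrite ler_pM2r// ler_nat.
rewrite natrX natrM -exprMn lerXn2r ?nnegrE ?mulr_ge0 ?(ltW s0)//.
by move: K4; rewrite ler_pdivlMr//; lra.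
Qed.

(** The volume bound gives b (s / 2)^d <= 4 H (r + s) <= 8 H r, hence c s^d <= 8 H 6^d r. The term
    tau s^d is at most tau r because d >= 1 and s <= 1. *)
Lemma sample_size_near_cells (h r H : R) (b c : nat) : (0 < d)%N ->
  0 <= H -> s <= r -> s / 2 <= h -> b%:R * h ^+ d <= 4 * H * (r + s) ->
  (c <= b * 3 ^ d)%N ->
  (tau + c%:R) / n%:R <= (1 + 8 * H * 6 ^+ d) * (r * (tau / (s ^+ d * n%:R))).
Proof.
move=> d0 H0 sr sh bh cb; rewrite mulrA; apply: sample_size_ge_card.
have r0 : 0 < r by exact: lt_le_trans sr.
rewrite mulrDl [in leRHS]mulrDl [in leRHS]mulrDl mul1r; apply: lerD.
  rewrite mulrC ler_pM2r//; apply: le_trans sr.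
  by rewrite -[leRHS]expr1 ler_wiXn2l// ?ltW.
apply: (@le_trans _ _ (8 * H * 6 ^+ d * r)); last first.
  by rewrite ler_peMr// !mulr_ge0 ?exprn_ge0// ltW.
have -> : 6 ^+ d = 3 ^+ d * 2 ^+ d :> R by rewrite -exprMn -natrM.
apply: (@le_trans _ _ ((b * 3 ^ d)%:R * s ^+ d)).
  by rewrite ler_pM2r// ler_nat.
have : b%:R * (s / 2) ^+ d <= 8 * H * r.
  apply: (@le_trans _ _ (b%:R * h ^+ d)).
    by rewrite ler_wpM2l// lerXn2r ?nnegrE// ?divr_ge0 ?(ltW s0)// (le_trans _ sh)// divr_ge0// ltW.
  apply: (le_trans bh); have : H * s <= H * r by rewrite ler_wpM2l.
  lra.
move=> h0; have h1 : b%:R * s ^+ d <= 8 * H * r * 2 ^+ d.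
  by rewrite -ler_pdivrMr ?exprn_gt0// -[leLHS]mulrA -expr_div_n.
have : 3 ^+ d * (b%:R * s ^+ d) <= 3 ^+ d * (8 * H * r * 2 ^+ d).
  by rewrite ler_pM2l// exprn_gt0.
rewrite natrM natrX; move: (3 ^+ d) (2 ^+ d) (s ^+ d) => x y z.
lra.
Qed.

End sample_size.

(** * The excess risk in terms of the separating radius *)

Section histogram_rate.
Context (R : realType) (d : nat) (P : probability ('rV[R]_d * bool)%type R).
Variables (eta : 'rV[R]_d -> R) (beta : \bar R).
Variables (gamma cLC cME cMNE s tau : R) (n : nat) (A : nat -> set 'rV[R]_d).
Hypothesis gamma0 : 0 < gamma.
Hypothesis cLC0 : 0 < cLC.
Hypothesis cME0 : 0 < cME.
Hypothesis PD : P (domain `*` setT) = 1%E.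
Hypothesis post : is_posterior P eta.
Hypothesis noise : controls_noise P eta gamma cLC.
Hypothesis beta0 : (0 < beta)%E.
Hypothesis MNE : has_MNE P eta beta cMNE.
Hypothesis bpos : Xzero eta = rel_boundary (Xpos eta).
Hypothesis bneg : Xzero eta = rel_boundary (Xneg eta).
Hypothesis s01 : 0 < s <= 1.
Hypothesis cpA : cubic_partition s A.
Hypothesis n0 : (0 < n)%N.
Hypothesis tau1 : 1 <= tau.

Let eps : R := tau / (s ^+ d * n%:R).
Let s0 : 0 < s. Proof. by case/andP: s01. Qed.
Let tau0 : 0 < tau. Proof. exact: lt_le_trans tau1. Qed.

Lemma eps_gt0 : 0 < eps.
Proof. by rewrite /eps divr_gt0// mulr_gt0 ?exprn_gt0// ltr0n. Qed.

Section regions.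
Variable N : nat.
Implicit Types (B : {set 'I_N}) (u : R).

Let mass B : R := fine (noise_mass P eta (region A B)).
Let prob B : R := fine (marginal P (region A B)).

Lemma massE B : noise_mass P eta (region A B) = (mass B)%:E.
Proof. by rewrite (region_mass_fin post cpA). Qed.

Lemma probE B : marginal P (region A B) = (prob B)%:E.
Proof. by rewrite fineK// fin_num_measure//; exact: (measurable_region cpA). Qed.

Lemma mass_ge0 B : 0 <= mass B.
Proof. by rewrite -lee_fin -massE noise_mass_ge0. Qed.

Lemma prob_le B u (v : R) : 0 < u ->
  (marginal P [set x | domain x /\ (Delta eta x < u%:E)%E] <= v%:E)%E ->
  prob B <= v + cLC * u `^ (- gamma) * mass B.
Proof.
move=> u0 hv; rewrite -lee_fin -probE EFinD EFinM -massE.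
have := marginal_le post (ltW gamma0) noise (measurable_region cpA B)
  (@region_domain _ _ _ _ B) u0.
by move/le_trans; apply; apply: leeD.
Qed.

Lemma prob_far_le B u : 0 < u ->
  (forall x, region A B x -> (u%:E <= Delta eta x)%E) ->
  prob B <= cLC * u `^ (- gamma) * mass B.
Proof.
move=> u0 hu; rewrite -lee_fin -probE EFinM -massE.
exact: (marginal_far_le post (ltW gamma0) noise (measurable_region cpA B)
  (@region_domain _ _ _ _ B) u0 hu).
Qed.

End regions.

Lemma histogram_rate_pow (a H deltastar r : R) : 0 < a -> 0 <= H -> (0 < d)%N ->
  has_ME P eta a%:E cME ->
  (forall delta : R, 0 < delta <= deltastar ->
     (lebesgue_rV [set x : 'rV[R]_d | domain x /\ (Delta eta x <= delta%:E)%E]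
      <= (4 * H * delta)%:E)%E) ->
  s <= r -> r <= deltastar / 3 ->
  ((1 - 2 * expR (- tau))%:E <= power_measure P
    [set D : n.-tuple ('rV[R]_d * bool)%type |
      (risk P (hist_rule A D) - bayes_risk P <= 6%:E * xpow (cMNE * s) beta +
       ((2 * (cME `^ a + cLC) * ((1 + 8 * H * 6 ^+ d) * (r * eps)))
           `^ ((a + gamma) / (a + 2 * gamma)) +
        2 * (cLC * r `^ (- gamma)) * ((1 + 12 ^+ d) * eps))%:E)%E])%E.
Proof.
move=> a0 H0 d0 [_ ME] volume sr rdelta.
have r0 : 0 < r by exact: lt_le_trans sr.
have [K [K0 hs sh K4]] := grid_size s01.
have [N [Jn [Jf [cover cardn cardf cardnear far]]]] :=
  cell_cover_card cpA s0 K0 hs eta r.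
have L0 (c : nat) : 0 <= (tau + c%:R) / n%:R.
  by rewrite divr_ge0// addr_ge0// ltW.
have near_count : #|near_box K eta r|%:R * (2 / K%:R) ^+ d <= 4 * H * (r + s).
  rewrite -lee_fin; apply: (le_trans (near_box_volume s0 K0 hs (ltW r0) bpos bneg)).
  (* The bound at [deltastar] applies because r + s <= 2 r <= 2 deltastar / 3. *)
  by apply: volume; apply/andP; split; lra.
have key := histogram_excess_risk PD post cpA (ltW s0) n0 cover (ltW tau0).
set M1 := _ `^ ((a + gamma) / _); set M2 := 2 * _ * _.
suff [h1 h2] : (forall B : {set 'I_N}, B \subset Jn ->
    fine (noise_mass P eta (region A B)) ^+ 2 <=
      2 * fine (marginal P (region A B)) * ((tau + #|Jn|%:R) / n%:R) ->
    fine (noise_mass P eta (region A B)) <= M1) /\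
   (forall B : {set 'I_N}, B \subset Jf ->
    fine (noise_mass P eta (region A B)) ^+ 2 <=
      2 * fine (marginal P (region A B)) * ((tau + #|Jf|%:R) / n%:R) ->
    fine (noise_mass P eta (region A B)) <= M2).
  apply: (le_trans (key M1 M2 h1 h2)).
  apply: power_measure_mono => D /= hD; apply: (le_trans hD).
  apply: leeD; last exact: lexx.
  exact: (noise_mass_near_boundary post MNE s0 beta0).
split=> B BJ hB.
- apply: le_trans (margin_selfbound a0 gamma0 (L0 #|Jn|) cME0 cLC0 (mass_ge0 B) hB _) _.
    by move=> u u0; apply: prob_le => //; exact: ME.
  apply: ge0_ler_powR; rewrite ?nnegrE.
  + by rewrite divr_ge0 ?addr_ge0 ?mulr_ge0 ?(ltW a0) ?(ltW gamma0).
  + by rewrite mulr_ge0// mulr_ge0// addr_ge0 ?powR_ge0// ltW.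
  + apply: mulr_ge0; first by rewrite mulr_ge0// addr_ge0 ?powR_ge0// ltW.
    apply: mulr_ge0; first by rewrite addr_ge0// mulr_ge0 ?exprn_ge0// mulr_ge0.
    by rewrite mulr_ge0 ?(ltW r0)//; exact/ltW/eps_gt0.
  + rewrite ler_wpM2l//; first by rewrite mulr_ge0// addr_ge0 ?powR_ge0// ltW.
    exact: (sample_size_near_cells s01 n0 tau1 d0 H0 sr sh near_count cardnear).
- have V0 : 0 <= cLC * r `^ (- gamma) by rewrite mulr_ge0 ?powR_ge0// ltW.
  apply: le_trans (linear_selfbound (L0 #|Jf|) V0 (mass_ge0 B) hB _) _.
    apply: prob_far_le => // x [dx [j /= jB Ajx]].
    by apply: ltW; apply: (far j) => //; exact: (fintype.subsetP BJ).
  rewrite /M2 ler_wpM2l//; first by rewrite mulr_ge0.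
  exact: (sample_size_cells s01 n0 tau1 K4 cardf).
Qed.

(** At u = 1 / (2 cME) the margin condition makes {Delta < u} a null set, so every cell obeys the
    linear bound with this fixed [u]. Both families get the same bound, whence the factor 4 = 2 +
    2. *)
Lemma histogram_rate_infty : has_ME P eta +oo%E cME ->
  ((1 - 2 * expR (- tau))%:E <= power_measure P
    [set D : n.-tuple ('rV[R]_d * bool)%type |
      (risk P (hist_rule A D) - bayes_risk P <= 6%:E * xpow (cMNE * s) beta +
       (4 * (cLC * (2 * cME)^-1 `^ (- gamma)) * (1 + 12 ^+ d) * eps)%:E)%E])%E.
Proof.
move=> [_ ME].
have [K [K0 hs sh K4]] := grid_size s01.
have [N [Jn [Jf [cover cardn cardf _ _]]]] := cell_cover_card cpA s0 K0 hs eta 0.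
have L0 (c : nat) : 0 <= (tau + c%:R) / n%:R.
  by rewrite divr_ge0// addr_ge0// ltW.
pose u : R := (2 * cME)^-1.
have u0 : 0 < u by rewrite invr_gt0 mulr_gt0.
have V0 : 0 <= cLC * u `^ (- gamma) by rewrite mulr_ge0 ?powR_ge0// ltW.
have ME0 : (marginal P [set x | domain x /\ (Delta eta x < u%:E)%E] <= 0%:E)%E.
  apply: (le_trans (ME u u0)); rewrite /= /u.
  rewrite (_ : cME * (2 * cME)^-1 = 2^-1); last by field; rewrite gt_eqF.
  by rewrite invf_lt1// ltr1n.
have key := histogram_excess_risk PD post cpA (ltW s0) n0 cover (ltW tau0).
pose M := 2 * (cLC * u `^ (- gamma)) * ((1 + 12 ^+ d) * eps).
have bound (J B : {set 'I_N}) : (#|J| <= (3 * K) ^ d)%N ->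
    fine (noise_mass P eta (region A B)) ^+ 2 <=
      2 * fine (marginal P (region A B)) * ((tau + #|J|%:R) / n%:R) ->
    fine (noise_mass P eta (region A B)) <= M.
  move=> cardJ hB.
  apply: le_trans (linear_selfbound (L0 #|J|) V0 (mass_ge0 B) hB _) _.
    by rewrite -[leRHS]add0r; exact: prob_le.
  rewrite /M ler_wpM2l//; first by rewrite mulr_ge0.
  exact: (sample_size_cells s01 n0 tau1 K4 cardJ).
have bn (B : {set 'I_N}) : B \subset Jn -> _ := fun _ => bound Jn B cardn.
have bf (B : {set 'I_N}) : B \subset Jf -> _ := fun _ => bound Jf B cardf.
apply: (le_trans (key M M bn bf)).
apply: power_measure_mono => D /= hD; apply: (le_trans hD); apply: leeD.
  exact: (noise_mass_near_boundary post MNE s0 beta0).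
by rewrite lee_fin /M -/u; lra.
Qed.

End histogram_rate.

(** * The constant [ctilde] and the final choice of constants *)

Section ctilde_sign.
Context (R : realType) (d : nat) (alpha : \bar R) (cLC cME H : R).
Hypothesis alpha_gt0 : (0 < alpha)%E.

(** The base of [ctilde] has a factor gamma, and the exponents are positive at gamma = 0. The bound
    on [s] in the theorem then reads s <= 0. *)
Lemma ctilde_gamma0 :
  ctilde d alpha 0 cLC cME H `^ exp_s_const d alpha 0 = 0.
Proof.
case: alpha alpha_gt0 => [a| |] //; rewrite ?lte_fin /ctilde /exp_s_const /kexp.
  move=> a0; rewrite !(mulr0, mul0r, addr0, add0r, mul1r) divff ?gt_eqF//.
  by rewrite powRr1// powR0// expr0n /= addr0 divff ?gt_eqF// oner_neq0.
by move=> _; rewrite !(mulr0, mul0r, addr0) invr1 powRr1// powR0 ?oner_neq0.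
Qed.

Lemma ctilde_gt0 gamma : 0 < gamma -> 0 < ctilde d alpha gamma cLC cME H.
Proof.
move=> g0.
have max0 : 0 < Num.max cLC (2 `^ gamma) by rewrite lt_max powR_gt0 ?orbT.
have chat0 : 0 < chat alpha gamma cLC cME H.
  by rewrite /chat !mulr_gt0// lt_max ltr01 ?orbT.
case: alpha alpha_gt0 chat0 => [a| |] //; rewrite ?lte_fin => a0 chat0;
  apply: powR_gt0.
  by rewrite divr_gt0 ?powR_gt0// !mulr_gt0 ?invr_gt0 ?exprn_gt0 ?addr_gt0// mulr_gt0.
by rewrite divr_gt0// !mulr_gt0// exprn_gt0.
Qed.

End ctilde_sign.

(* The constant c is chosen before the distribution, the partition, s, n, tau,
   beta, cMNE and delta*: it depends on alpha, gamma, d and on the fixed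
   constants cLC, cME, H = H^{d-1}(X_0) that also enter ctilde. *)
Theorem theorem3p5 (R : realType) (d : nat) (alpha : \bar R)
    (gamma cLC cME H : R)
    (alpha_gt0 : (0 < alpha)%E) (gamma_ge0 : 0 <= gamma)
    (cLC_gt0 : 0 < cLC) (cME_gt0 : 0 < cME) (H_gt0 : 0 < H) :
  exists2 c : R, 0 < c &
    forall (P : probability ('rV[R]_d * bool)%type R) (eta : 'rV[R]_d -> R)
      (beta : \bar R) (cMNE deltastar s tau : R) (n : nat)
      (A : nat -> set 'rV[R]_d),
    P (domain `*` setT) = 1%E ->
    is_posterior P eta ->
    controls_noise P eta gamma cLC ->
    (0 < beta)%E ->
    has_MNE P eta beta cMNE ->
    has_ME P eta alpha cME ->
    Xzero eta = rel_boundary (Xpos eta) ->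
    Xzero eta = rel_boundary (Xneg eta) ->
    hausdorff d.-1 (Xzero eta) = H%:E ->
    rectifiable d.-1 (Xzero eta) ->
    0 < deltastar ->
    (forall delta : R, 0 < delta <= deltastar ->
       (lebesgue_rV [set x | domain x /\ (Delta eta x <= delta%:E)%E]
        <= (4 * H * delta)%:E)%E) ->
    0 < s <= 1 ->
    cubic_partition s A ->
    (1 <= n)%N ->
    1 <= tau ->
    s <= ctilde d alpha gamma cLC cME H `^ exp_s_const d alpha gamma
         * (tau / n%:R) `^ exp_s_sample d alpha gamma ->
    (tau%:E * xpow (ctilde d alpha gamma cLC cME H
                    / Num.min (deltastar / 3) 1)%R (exp_n alpha gamma)
     <= (s ^+ d * n%:R)%:E)%E ->
    (power_measure P
       [set D : n.-tuple ('rV[R]_d * bool)%type |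
         (risk P (hist_rule A D) - bayes_risk P
          <= 6%:E * xpow (cMNE * s)%R beta
             + (c * (tau / (s ^+ d * n%:R)) `^ exp_rate alpha gamma)%:E)%E]
     >= (1 - 2 * expR (- tau))%:E)%E.
Proof.
move: gamma_ge0; rewrite le_eqVlt => /predU1P[<-|g0].
  exists 1 => // P eta beta cMNE deltastar s tau n A _ _ _ _ _ _ _ _ _ _ _ _.
  by move=> /andP[s0 _] _ _ _; rewrite ctilde_gamma0// mul0r leNgt s0.
have ct0 := ctilde_gt0 d cLC cME H alpha_gt0 g0.
case: alpha alpha_gt0 ct0 => [a| |] // alpha_gt0; set ct := ctilde _ _ _ _ _ _ => ct0.
- have a0 : 0 < a by rewrite -lte_fin.
  have k0 : 0 < kexp gamma a.
    by rewrite /kexp addr_gt0 ?mulr_gt0 ?addr_gt0 ?exprn_gt0.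
  (* In [histogram_rate_pow], [c1] is the factor of r eps inside the power and [c2] that of r^-gamma
     eps in the far term. *)
  pose c1 := 2 * (cME `^ a + cLC) * (1 + 8 * H * 6 ^+ d).
  pose c2 := 2 * cLC * (1 + 12 ^+ d).
  have c10 : 0 < c1.
    rewrite mulr_gt0// ?mulr_gt0 ?addr_gt0 ?powR_gt0//.
    by rewrite mulr_gt0 ?exprn_gt0// mulr_gt0.
  have c20 : 0 < c2 by rewrite !mulr_gt0 ?addr_gt0 ?exprn_gt0.
  exists ((c1 * ct) `^ ((a + gamma) / (a + 2 * gamma)) + c2 * ct `^ (- gamma)).
    by apply: addr_gt0; [apply: powR_gt0|]; apply: mulr_gt0 => //; exact: powR_gt0.
  move=> P eta beta cMNE deltastar s tau n A PD post noise beta0 MNE ME bpos bneg _.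
  move=> [d0 _] dl0 volume s01 cpA n0 tau1 le_s le_n.
  have s0 : 0 < s by case/andP: s01.
  have tau0 : 0 < tau by exact: lt_le_trans tau1.
  have n0R : 0 < n%:R :> R by rewrite ltr0n.
  have sd0 : 0 < s ^+ d by rewrite exprn_gt0.
  have e0 := eps_gt0 d s01 n0 tau1.
  set e := tau / _ in e0 *.
  pose r := ct * e `^ (gamma / kexp gamma a).
  (* The first assumption on [s] gives s <= r, the second r <= min (deltastar / 3) 1. *)
  have sr : s <= r.
    have -> : r = ct * (tau / n%:R / s ^+ d) `^ (gamma / kexp gamma a).
      by rewrite /r /e [s ^+ d * _]mulrC invfM mulrA.
    by apply: side_le_radius => //; rewrite divr_gt0.
  have min0 : 0 < Num.min (deltastar / 3) 1 by rewrite lt_min ltr01 andbT divr_gt0.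
  have rdl : r <= deltastar / 3.
    apply: (@le_trans _ _ (Num.min (deltastar / 3) 1)); last by rewrite ge_min lexx.
    apply: radius_le => //; by rewrite mulr_gt0.
  (* Rectifiability in dimension d - 1 includes d - 1 > 0. *)
  have d1 : (0 < d)%N by exact: leq_trans d0 (leq_pred d).
  have := histogram_rate_pow g0 cLC_gt0 cME_gt0 PD post noise beta0 MNE bpos bneg
    s01 cpA n0 tau1 a0 (ltW H_gt0) d1 ME volume sr rdl.
  rewrite -/e mulrA -/c1 near_rate// ?(ltW c10)//.
  have -> : 2 * (cLC * r `^ (- gamma)) * ((1 + 12 ^+ d) * e) =
      c2 * ct `^ (- gamma) * e `^ exp_rate a%:E gamma.
    by rewrite -[RHS]mulrA -(far_rate a0 g0 ct0 e0) -/r /c2; ring.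
  by rewrite -mulrDl.
- pose V := 4 * (cLC * (2 * cME)^-1 `^ (- gamma)) * (1 + 12 ^+ d).
  exists V.
    apply: mulr_gt0; last by rewrite addr_gt0 ?exprn_gt0.
    by rewrite !mulr_gt0// powR_gt0// invr_gt0 mulr_gt0.
  move=> P eta beta cMNE deltastar s tau n A PD post noise beta0 MNE ME bpos bneg.
  move=> _ _ _ _ s01 cpA n0 tau1 _ _.
  (* For alpha = +oo the exponent [exp_rate] is 1. *)
  rewrite powRr1; last exact/ltW/eps_gt0.
  exact: (histogram_rate_infty g0 cLC_gt0 cME_gt0 PD post noise beta0 MNE
    s01 cpA n0 tau1 ME).
Qed.
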